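(* Let $M\subset\mathbb{R}^m$ and $N\subset\mathbb{R}^n$ be semialgebraic sets. The rings $\mathcal{S}(N)$ and $\mathcal{S}^*(M)$ are isomorphic if and only if the semialgebraic set $N$ is compact and the semialgebraic sets $N\setminus\eta(N)$ and $M\setminus\eta(M)$ are semialgebraically homeomorphic.
   Context: A map $f:M\to\mathbb{R}^n$ on a semialgebraic set $M\subset\mathbb{R}^m$ is called semialgebraic if it is continuous and its graph is a semialgebraic subset of $\mathbb{R}^{m+n}$. $\mathcal{S}(M)$ denotes the commutative unital ring of all (continuous) semialgebraic functions $M\to\mathbb{R}$ with pointwise operations, and $\mathcal{S}^*(M)$ its subring of bounded functions. A semialgebraic homeomorphism is a semialgebraic map that is a homeomorphism; two semialgebraic sets are semialgebraically homeomorphic if there is a semialgebraic homeomorphism between them. For a semialgebraic set $M$, $\eta(M)$ is the (finite) set of points $p\in M$ that have an open neighborhood in $M$ that is semialgebraically homeomorphic to the interval $[0,1)$ by a homeomorphism sending $p$ to $0$. *)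

(* Defs.v *)
From HB Require Import structures.
From mathcomp Require Import all_boot all_order all_algebra.
From mathcomp Require Import ordered_qelim qe_rcf.
From mathcomp Require Import boolp classical_sets functions reals.
From mathcomp Require Import topology normedtype.
(* The notations of mpoly clash with those of topology. *)
From mathcomp Require Import -(notations) mpoly.
Import numFieldNormedType.Exports.
Import Order.TTheory GRing.Theory Num.Theory.

Set Implicit Arguments.
Unset Strict Implicit.
Unset Printing Implicit Defensive.

Local Open Scope classical_set_scope.
Local Open Scope ring_scope.

Inductive semialgebraic (R : realType) (n : nat) : set 'rV[R]_n -> Prop :=
| semialgebraic_eq0 (p : mpoly n R) :
    semialgebraic [set x | meval (x 0) p = 0]
| semialgebraic_gt0 (p : mpoly n R) :
    semialgebraic [set x | 0 < meval (x 0) p]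
| semialgebraicU (A B : set 'rV[R]_n) :
    semialgebraic A -> semialgebraic B -> semialgebraic (A `|` B)
| semialgebraicI (A B : set 'rV[R]_n) :
    semialgebraic A -> semialgebraic B -> semialgebraic (A `&` B)
| semialgebraicC (A : set 'rV[R]_n) :
    semialgebraic A -> semialgebraic (~` A).

Section TarskiSeidenberg.
Variable R : realType.

Definition row_env n (x : 'rV[R]_n) : seq R :=
  mkseq (fun i => if insub i is Some j then x 0 j else 0) n.

Lemma nth_row_env n (x : 'rV[R]_n) (i : 'I_n) : nth 0 (row_env x) i = x 0 i.
Proof. by rewrite nth_mkseq // valK. Qed.

(* Only meaningful on terms without inverses, see mpoly_of_termE. *)
Fixpoint mpoly_of_term n (t : GRing.term R) : mpoly n R :=
  match t with
  | GRing.Var i => if insub i is Some j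
      then mpolyX R (mnm1 j) else 0
  | GRing.Const c => mpolyC n c
  | GRing.NatConst k => k%:R
  | GRing.Add s u => mpoly_of_term n s + mpoly_of_term n u
  | GRing.Opp s => - mpoly_of_term n s
  | GRing.NatMul s k => mpoly_of_term n s *+ k
  | GRing.Mul s u => mpoly_of_term n s * mpoly_of_term n u
  | GRing.Inv s => 0
  | GRing.Exp s k => mpoly_of_term n s ^+ k
  end.

Lemma mpoly_of_termE n t (x : 'rV[R]_n) : GRing.rterm t ->
  meval (x 0) (mpoly_of_term n t) = GRing.eval (row_env x) t.
Proof.
elim: t => //=.
- move=> i _; case: insubP => [j _ <-|].
    by rewrite nth_row_env mevalXU.
  by move=> ni; rewrite meval0 nth_default // size_mkseq leqNgt.
- by move=> c _; rewrite mevalC.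
- by move=> k _; rewrite rmorph_nat.
- by move=> s IHs u IHu /andP[/IHs <- /IHu <-]; rewrite mevalD.
- by move=> s IHs /IHs <-; rewrite mevalN.
- by move=> s IHs k /IHs <-; rewrite mevalMn.
- by move=> s IHs u IHu /andP[/IHs <- /IHu <-]; rewrite mevalM.
- by move=> s IHs k /IHs <-; rewrite rmorphXn.
Qed.

Lemma semialgebraic_ext n (A B : set 'rV[R]_n) :
  (forall x, A x <-> B x) -> semialgebraic A -> semialgebraic B.
Proof. by move=> AB sA; rewrite -(_ : A = B)//; apply/seteqP; split => x /AB. Qed.

Lemma semialgebraic_qf n (f : ord.formula R) :
  ord.qf_form f -> ord.rformula f ->
  semialgebraic [set x : 'rV[R]_n | ord.holds (row_env x) f].
Proof.
have sT : @semialgebraic R n setT.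
  apply: semialgebraic_ext (semialgebraic_eq0 0) => x /=.
  by rewrite meval0.
have slt s u : GRing.rterm s -> GRing.rterm u -> semialgebraic
    [set x : 'rV[R]_n | GRing.eval (row_env x) s < GRing.eval (row_env x) u].
  move=> rs ru; apply: semialgebraic_ext
    (semialgebraic_gt0 (mpoly_of_term n u - mpoly_of_term n s)) => x /=.
  by rewrite mevalB subr_gt0 !mpoly_of_termE.
elim: f => //=.
- case=> _ _; first exact: semialgebraic_ext sT.
  by apply: semialgebraic_ext (semialgebraicC sT) => x /=; split => // nT; apply: nT.
- move=> s u _ /andP[rs ru]; apply: semialgebraic_ext
    (semialgebraic_eq0 (mpoly_of_term n s - mpoly_of_term n u)) => x /=.
  rewrite mevalB !mpoly_of_termE //.
  by split => [/eqP|->]; rewrite ?subrr// subr_eq0 => /eqP.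
- by move=> s u _ /andP[rs ru]; exact: slt.
- move=> s u _ /andP[rs ru].
  apply: semialgebraic_ext (semialgebraicC (slt u s ru rs)) => x /=.
  by rewrite leNgt; split => /negP.
- by move=> f IHf g IHg /andP[/IHf F /IHg G] /andP[/F {}F /G {}G];
    exact: semialgebraicI.
- by move=> f IHf g IHg /andP[/IHf F /IHg G] /andP[/F {}F /G {}G];
    exact: semialgebraicU.
- move=> f IHf g IHg /andP[/IHf F /IHg G] /andP[/F {}F /G {}G].
  apply: semialgebraic_ext (semialgebraicU (semialgebraicC F) G) => x /=.
  by split=> [[]//|h]; have [?|?] := pselect (ord.holds (row_env x) f);
    [right; apply: h|left].
- by move=> f IHf /IHf F /F {}F; exact: semialgebraicC.
Qed.

Lemma semialgebraic_formula n (f : ord.formula R) :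
  semialgebraic [set x : 'rV[R]_n | ord.holds (row_env x) f].
Proof.
have rf := ord.to_rform_rformula f.
have /andP[qf rq] := ord.quantifier_elim_wf (@wf_QE_wproj R) rf.
apply: semialgebraic_ext (semialgebraic_qf n qf rq) => x /=.
apply: iff_trans (ord.to_rformP _ _).
apply: iff_trans (iff_sym (rwP (ord.quantifier_elim_rformP
  (@wf_QE_wproj R) (@valid_QE_wproj R) (row_env x) rf))).
exact: (rwP (ord.qf_evalP (row_env x) qf)).
Qed.

Lemma term_of_mpoly n (p : mpoly n R) : exists t : GRing.term R,
  forall e, GRing.eval e t = meval (fun i : 'I_n => nth 0 e i) p.
Proof.
elim/mpolyind: p => [|c m p _ _ [t tE]].
  by exists 0%:R%T => e; rewrite meval0.
pose mon : GRing.term R := foldr (fun i : 'I_n => GRing.Mul ('X_i ^+ (m i))%T) 1%:R%T (enum 'I_n).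
exists (GRing.Add (GRing.Mul (GRing.Const c) mon) t) => e /=.
rewrite mevalD mevalZ mevalX tE; congr (_ * _ + _).
rewrite -big_enum /= /mon; elim: (enum _) => [|i s IH] /=; first by rewrite big_nil.
by rewrite big_cons IH.
Qed.

Lemma formula_semialgebraic n (A : set 'rV[R]_n) : semialgebraic A ->
  exists f : ord.formula R, forall e,
    ord.holds e f <-> A (\row_i nth 0 e i).
Proof.
have ev e p : meval ((\row_i nth 0 e i : 'rV[R]_n) 0) p =
    meval (fun i : 'I_n => nth 0 e i) p.
  by apply: meval_eq => i; rewrite mxE.
elim=> [p|p|B C _ [f fE] _ [g gE]|B C _ [f fE] _ [g gE]|B _ [f fE]].
- have [t tE] := term_of_mpoly p.
  by exists (ord.Equal t 0%:R%T) => e /=; rewrite tE ev.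
- have [t tE] := term_of_mpoly p.
  by exists (ord.Lt 0%:R%T t) => e /=; rewrite tE ev.
- by exists (ord.Or f g) => e /=; rewrite fE gE.
- by exists (ord.And f g) => e /=; rewrite fE gE.
- by exists (ord.Not f) => e /=; rewrite fE.
Qed.

Lemma semialgebraic_proj n (A : set 'rV[R]_(n + 1)) : semialgebraic A ->
  semialgebraic [set x : 'rV[R]_n | exists t : R, A (row_mx x (const_mx t))].
Proof.
move=> /formula_semialgebraic[f fE].
apply: semialgebraic_ext (semialgebraic_formula n (ord.Exists n f)) => x /=.
suff E t : \row_i nth 0 (set_nth 0 (row_env x) n t) i =
    row_mx x (const_mx t) :> 'rV[R]_(n + 1).
  by split=> -[t]; [move/fE; rewrite E|move=> At]; exists t => //;
    apply/fE; rewrite E.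
apply/rowP => i; rewrite !mxE nth_set_nth /=; case: splitP => [j ij|j ij].
  by rewrite ij ltn_eqF // nth_row_env.
by rewrite ij ord1 addn0 eqxx mxE.
Qed.

Lemma semialgebraic_preimage n k (phi : 'I_k -> mpoly n R)
    (A : set 'rV[R]_k) : semialgebraic A ->
  semialgebraic [set x : 'rV[R]_n | A (\row_i meval (x 0) (phi i))].
Proof.
have ev (x : 'rV[R]_n) p :
    meval ((\row_i meval (x 0) (phi i) : 'rV[R]_k) 0) p =
    meval (x 0) (comp_mpoly [tuple phi i | i < k] p).
  rewrite comp_mpoly_meval; apply: meval_eq => i.
  by rewrite mxE tnth_mktuple.
elim=> [p|p|B C _ sB _ sC|B C _ sB _ sC|B _ sB].
- by under eq_set do rewrite /= ev; exact: semialgebraic_eq0.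
- by under eq_set do rewrite /= ev; exact: semialgebraic_gt0.
- exact: semialgebraicU.
- exact: semialgebraicI.
- exact: semialgebraicC.
Qed.

Lemma semialgebraic_reindex n k (s : 'I_k -> 'I_n) (A : set 'rV[R]_k) :
  semialgebraic A -> semialgebraic [set x : 'rV[R]_n | A (\row_i x 0 (s i))].
Proof.
move=> /(semialgebraic_preimage (fun i => mpolyX R (mnm1 (s i)))).
apply: semialgebraic_ext => x /=; rewrite (_ : \row__ _ = \row_i x 0 (s i)) //.
by apply/rowP => i; rewrite !mxE mevalXU.
Qed.

End TarskiSeidenberg.

(* A set M used as a type is set_type M, with the topology induced by the
   ambient space. *)
Definition fun_graph (R : realType) (m k : nat) (M : set 'rV[R]_m)
    (f : M -> 'rV[R]_k) : set 'rV[R]_(m + k) :=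
  [set row_mx (set_val x) (f x) | x in [set: M]].

Definition semialg_map (R : realType) (m k : nat) (M : set 'rV[R]_m)
    (f : M -> 'rV[R]_k) : Prop :=
  continuous f /\ semialgebraic (fun_graph f).

(* R is identified with 'rV[R]_1 to form the graph. *)
Definition semialg_fun (R : realType) (m : nat) (M : set 'rV[R]_m)
    (f : M -> R) : Prop :=
  continuous f /\ semialgebraic (fun_graph (fun x => const_mx (f x) : 'rV[R]_1)).

Section SemialgFunRing.
Variables (R : realType) (m : nat) (M : set 'rV[R]_m).

Let gr (f : M -> R) : set 'rV[R]_(m + 1) :=
  fun_graph (fun x => const_mx (f x) : 'rV[R]_1).

Lemma semialgebraic_graph_op (op : R -> R -> R) (f g : M -> R) :
  (forall n (i j k : 'I_n),
    semialgebraic [set x : 'rV[R]_n | x 0 k = op (x 0 i) (x 0 j)]) ->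
  semialgebraic (gr f) -> semialgebraic (gr g) ->
  semialgebraic (gr (fun x => op (f x) (g x))).
Proof.
move=> sop sf sg.
pose l2 (i : 'I_(m + 1)) : 'I_(m + 1 + 1 + 1) := lshift 1 (lshift 1 i).
pose it := lshift 1 (rshift (m + 1) (0 : 'I_1)) : 'I_(m + 1 + 1 + 1).
pose iu := rshift (m + 1 + 1) (0 : 'I_1) : 'I_(m + 1 + 1 + 1).
pose s (k : 'I_(m + 1 + 1 + 1)) (i : 'I_(m + 1)) :=
  if fintype.split i is inl j then l2 (lshift 1 j) else k.
have := semialgebraicI (semialgebraicI (semialgebraic_reindex (s it) sf)
  (semialgebraic_reindex (s iu) sg)) (sop _ it iu (l2 (rshift m 0))).
move=> /semialgebraic_proj/semialgebraic_proj.
apply: semialgebraic_ext => z /=.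
have wl2 t u i : row_mx (row_mx z (const_mx t : 'rV_1))
    (const_mx u : 'rV_1) 0 (l2 i) = z 0 i by rewrite !row_mxEl.
have wit t u : row_mx (row_mx z (const_mx t : 'rV_1))
    (const_mx u : 'rV_1) 0 it = t by rewrite row_mxEl row_mxEr mxE.
have wiu t u : row_mx (row_mx z (const_mx t : 'rV_1))
    (const_mx u : 'rV_1) 0 iu = u by rewrite row_mxEr mxE.
have sE t u k : \row_i row_mx (row_mx z (const_mx t : 'rV_1))
     (const_mx u : 'rV_1) 0 (s k i) =
   row_mx (lsubmx z) (const_mx (row_mx (row_mx z (const_mx t : 'rV_1))
     (const_mx u : 'rV_1) 0 k)).
  apply/rowP => i; rewrite mxE [RHS]mxE /s; case: splitP => j _.
    by rewrite wl2 [RHS]mxE.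
  by rewrite [RHS]mxE.
split.
  move=> [t [u [[]]]]; rewrite !sE wl2 wit wiu.
  move=> [x _ /eq_row_mx[zx /rowP/(_ 0)]]; rewrite !mxE => <-.
  move=> [y _ /eq_row_mx[zy /rowP/(_ 0)]]; rewrite !mxE => <- zr.
  have xy : x = y by apply: val_inj; rewrite -!set_valE zx zy.
  exists x => //; rewrite {3}xy zx -zr -[RHS]hsubmxK; congr row_mx.
  by apply/rowP => i; rewrite !mxE (ord1 i).
move=> [x _ zE]; exists (f x), (g x); rewrite !sE wl2 wit wiu -zE row_mxKl.
by rewrite row_mxEr mxE; split => //; split; exists x.
Qed.

Lemma semialg_fun_op (op : R -> R -> R) (f g : M -> R) :
  (forall n (i j k : 'I_n),
    semialgebraic [set x : 'rV[R]_n | x 0 k = op (x 0 i) (x 0 j)]) ->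
  continuous (fun x => op (f x) (g x)) ->
  semialg_fun f -> semialg_fun g -> semialg_fun (fun x => op (f x) (g x)).
Proof. by move=> sop cop [_ sf] [_ sg]; split=> //; exact: semialgebraic_graph_op. Qed.

Lemma semialg_funB (f g : M -> R) :
  semialg_fun f -> semialg_fun g -> semialg_fun (f - g).
Proof.
move=> sf sg; apply: (semialg_fun_op (op := fun a b => a - b)) => //.
  move=> n i j k; pose X l : mpoly n R := mpolyX R (mnm1 l).
  apply: semialgebraic_ext (semialgebraic_eq0 (X k - (X i - X j))) => x /=.
  rewrite !mevalB !mevalXU.
  by split=> [/eqP|->]; rewrite ?subrr// subr_eq0 => /eqP.
by move=> x; exact: (cvgB (proj1 sf x) (proj1 sg x)).
Qed.

Lemma semialg_funM (f g : M -> R) :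
  semialg_fun f -> semialg_fun g -> semialg_fun (f * g).
Proof.
move=> sf sg; apply: (semialg_fun_op (op := fun a b => a * b)) => //.
  move=> n i j k; pose X l : mpoly n R := mpolyX R (mnm1 l).
  apply: semialgebraic_ext (semialgebraic_eq0 (X k - (X i * X j))) => x /=.
  rewrite !mevalB mevalM !mevalXU.
  by split=> [/eqP|->]; rewrite ?subrr// subr_eq0 => /eqP.
by move=> x; exact: (cvgM (proj1 sf x) (proj1 sg x)).
Qed.

Lemma semialg_fun1 : semialgebraic M -> semialg_fun (1 : M -> R).
Proof.
move=> sM; split; first exact: (@cst_continuous _ _ (1 : R)).
have := semialgebraicI (semialgebraic_reindex (@lshift m 1) sM)
  (semialgebraic_eq0 (mpolyX R (mnm1 (rshift m (0 : 'I_1))) - 1)).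
apply: semialgebraic_ext => z /=.
have -> : \row_i z 0 (lshift 1 i) = lsubmx z by apply/rowP => i; rewrite !mxE.
rewrite mevalB mevalXU meval1; split.
  move=> [Mz /eqP]; rewrite subr_eq0 => /eqP z1.
  exists (exist _ (lsubmx z) (mem_set Mz)) => //.
  rewrite set_valE /= -[RHS]hsubmxK; congr row_mx.
  by apply/rowP => i; rewrite !mxE (ord1 i).
move=> [x _ <-]; rewrite row_mxKl row_mxEr mxE subrr; split=> //.
by rewrite set_valE; case: x => x xM; exact: set_mem.
Qed.

(* The constant 1 is a semialgebraic function on M only if M is semialgebraic:
   the ring structure depends on the proof hM. *)
Definition semialg_fun_pred of semialgebraic M : {pred (M -> R)} :=
  [pred f : M -> R | `[< semialg_fun f >]].

Lemma semialg_fun_subring (hM : semialgebraic M) :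
  subring_closed (semialg_fun_pred hM).
Proof.
split=> [|f g /asboolP sf /asboolP sg|f g /asboolP sf /asboolP sg]; apply/asboolP.
- exact: semialg_fun1.
- exact: semialg_funB.
- exact: semialg_funM.
Qed.

HB.instance Definition _ (hM : semialgebraic M) :=
  GRing.isSubringClosed.Build (M -> R)
    (semialg_fun_pred hM) (semialg_fun_subring hM).

Record semialg_ring (hM : semialgebraic M) := SemialgRing {
  semialg_ring_fun :> M -> R;
  semialg_ringP : semialg_ring_fun \in semialg_fun_pred hM }.

HB.instance Definition _ (hM : semialgebraic M) :=
  [isSub for @semialg_ring_fun hM].
HB.instance Definition _ (hM : semialgebraic M) :=
  [Choice of semialg_ring hM by <:].
HB.instance Definition _ (hM : semialgebraic M) :=
  GRing.SubChoice_isSubComPzRing.Build _ _ (semialg_ring hM) (subringClosedP _).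

Definition bounded_pred (hM : semialgebraic M) : {pred semialg_ring hM} :=
  [pred f : semialg_ring hM | `[< exists k : R, forall x, `|f x| <= k >]].

Lemma bounded_subring (hM : semialgebraic M) :
  subring_closed (@bounded_pred hM).
Proof.
split=> [|f g /asboolP[k fk] /asboolP[l gl]|f g /asboolP[k fk] /asboolP[l gl]];
  apply/asboolP.
- by exists 1 => x; rewrite [X in `|X|](_ : _ = 1) ?normr1.
- exists (k + l) => x; rewrite [X in `|X|](_ : _ = f x - g x) //.
  by rewrite (le_trans (ler_normB _ _)) ?lerD.
- exists (k * l) => x; rewrite [X in `|X|](_ : _ = f x * g x) //.
  by rewrite normrM ler_pM.
Qed.

HB.instance Definition _ (hM : semialgebraic M) :=
  GRing.isSubringClosed.Build (semialg_ring hM)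
    (@bounded_pred hM) (bounded_subring hM).

Record bounded_semialg_ring (hM : semialgebraic M) := BoundedSemialgRing {
  bounded_semialg_ring_val :> semialg_ring hM;
  bounded_semialg_ringP : bounded_semialg_ring_val \in @bounded_pred hM }.

HB.instance Definition _ (hM : semialgebraic M) :=
  [isSub for @bounded_semialg_ring_val hM].
HB.instance Definition _ (hM : semialgebraic M) :=
  [Choice of bounded_semialg_ring hM by <:].
HB.instance Definition _ (hM : semialgebraic M) :=
  GRing.SubChoice_isSubComPzRing.Build _ _ (bounded_semialg_ring hM) (subringClosedP _).
End SemialgFunRing.

Definition semialg_homeo (R : realType) (m n : nat) (A : set 'rV[R]_m)
    (B : set 'rV[R]_n) (h : A -> B) : Prop :=
  semialg_map (fun x => set_val (h x)) /\
  exists g : B -> A, [/\ cancel h g, cancel g h & continuous g].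

Definition semialg_homeomorphic (R : realType) (m n : nat) (A : set 'rV[R]_m)
    (B : set 'rV[R]_n) : Prop :=
  exists h : A -> B, semialg_homeo h.

Definition unit_Ico (R : realType) : set 'rV[R]_1 := [set x | 0 <= x 0 0 < 1].

Definition eta_set (R : realType) (m : nat) (M : set 'rV[R]_m) : set 'rV[R]_m :=
  [set p | exists U : set 'rV[R]_m,
    [/\ semialgebraic U,
        exists O : set 'rV[R]_m, open O /\ U = M `&` O &
        exists h : U -> @unit_Ico R, semialg_homeo h /\
          exists x : U, set_val x = p /\ set_val (h x) = 0]].

(* Main.v *)
From HB Require Import structures.
Require Import Defs.
From mathcomp Require Import all_boot all_order all_algebra.
From mathcomp Require Import boolp classical_sets functions reals.
From mathcomp Require Import topology normedtype sequences derive realfun.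
From mathcomp Require Import ring lra.
From mathcomp Require Import -(notations) mpoly.
Import numFieldNormedType.Exports.
Import Order.TTheory GRing.Theory Num.Theory.

Set Implicit Arguments.
Unset Strict Implicit.
Unset Printing Implicit Defensive.

Local Open Scope classical_set_scope.
Local Open Scope ring_scope.

(** The mechanism. An isomorphism identifies M with a dense subset of a compact
    set N to which every bounded semialgebraic function on M extends, and this
    happens exactly when every added point is the end of a half-open arc.

    Why ends are invisible to bounded functions. A semialgebraic subset of the
    line is, just to the right of any point, either everything or nothing
    ([sa_right_dichotomy]), because a polynomial has a constant sign there.
    Hence a bounded semialgebraic function of one variable has one-sided limits
    ([sa_fun1_right_limit]). Let E(M) = M \ eta(M). A bounded semialgebraic
    function on E(M) has a limit along the arc that ends at each point of
    eta(M), so it extends to M ([bounded_extension]), uniquely as E(M) is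
    dense. So S*(M) is the ring of bounded functions on E(M), and S(N), which
    is S*(N) when N is compact, is that of bounded functions on E(N). A
    homeomorphism of E(N) with E(M) then gives an isomorphism
    ([iso_of_homeo]).

    Why an isomorphism phi from S(N) to S*(M) has this form. It fixes the
    constants, because the only ring endomorphism of the real field is the
    identity, and it reflects positivity, because nonnegative functions are
    squares. All functions on N are therefore bounded, and the norm and the
    functions 1 / |p - x| force N to be compact ([source_compact]). Following
    phi by the evaluation at a point of M is the evaluation at some point of N
    ([point_evaluation]). This gives a semialgebraic map g from M to N with
    phi(f) = f o g ([embedding]); injectivity of phi makes g(M) dense, and
    surjectivity makes g a homeomorphism onto g(M) and makes the bounded
    functions on g(M) extend to N.

    Let p be a point of N outside g(M). Every bounded semialgebraic function on
    N \ {p} has a limit at p. If small spheres around p contained several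
    points of N, then some coordinate would vary on each of them; rescaled to
    vary from 0 to 1 on each sphere, it would have no limit at p
    ([limits_sphere_end]). The rescaling is continuous because a bounded
    semialgebraic function of one variable is continuous just to the right of
    any point ([sa_fun1_right_continuous], by Baire's theorem). So each small
    sphere around p meets N in exactly one point.

    This last property, [sphere_end], is equivalent to lying in eta(N)
    ([eta_setE]): one direction parametrizes the arc by the distance to p, the
    other uses that this distance increases along the arc near its end
    ([arc_dist_increasing]). It is a first-order condition, so eta(N) is
    semialgebraic, and it can be compared directly on N and on a dense subset:
    since N \ g(M) is contained in eta(N), the complements E(N) and E(g(M))
    are equal ([sphere_end_dense]). As g carries E(M) onto E(g(M)), it gives
    the homeomorphism. *)

(** * Definability *)

Section Definability.
Variable R : realType.
Notation V n := 'rV[R]_n.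
Notation sa A := (semialgebraic A).

Definition poly_fun k (F : V k -> R) :=
  exists p : mpoly k R, forall x, F x = meval (x 0) p.

Lemma poly_fun_coord k (i : 'I_k) : poly_fun (fun x : V k => x 0 i).
Proof. by exists (mpolyX R (mnm1 i)) => x; rewrite mevalXU. Qed.

Lemma sa_poly_preimage k n (A : set (V n)) (F : V k -> V n) :
  (forall i, poly_fun (fun x => F x 0 i)) -> sa A -> sa (fun x => A (F x)).
Proof.
move=> /choice[phi phiE] /(semialgebraic_preimage phi).
apply: semialgebraic_ext => x /=.
by rewrite (_ : \row__ _ = F x)//; apply/rowP => i; rewrite mxE phiE.
Qed.

Lemma poly_fun_lsub k n (i : 'I_k) : poly_fun (fun w : V (k + n) => lsubmx w 0 i).
Proof.
have [p pE] := poly_fun_coord (lshift n i).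
by exists p => x; rewrite -pE mxE.
Qed.

Lemma poly_fun_rsub k n (i : 'I_n) : poly_fun (fun w : V (k + n) => rsubmx w 0 i).
Proof.
have [p pE] := poly_fun_coord (rshift k i).
by exists p => x; rewrite -pE mxE.
Qed.

Lemma poly_fun_row k n1 n2 (F : V k -> V n1) (G : V k -> V n2) :
  (forall i, poly_fun (fun x => F x 0 i)) ->
  (forall i, poly_fun (fun x => G x 0 i)) ->
  forall i, poly_fun (fun x => row_mx (F x) (G x) 0 i).
Proof.
move=> pF pG i; rewrite -[i]splitK; case: fintype.split => j /=.
  by have [p pE] := pF j; exists p => x; rewrite row_mxEl.
by have [p pE] := pG j; exists p => x; rewrite row_mxEr.
Qed.

Lemma sa_ex k (Q : V k -> R -> Prop) :
  sa (fun w : V (k + 1) => Q (lsubmx w) (rsubmx w 0 0)) ->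
  sa (fun x => exists t, Q x t).
Proof.
move=> /semialgebraic_proj; apply: semialgebraic_ext => x.
by split=> -[t H]; exists t; move: H; rewrite /= row_mxKl row_mxKr mxE.
Qed.

(** Projection along a block of variables, one variable at a time. *)
Lemma sa_exv k n (Q : V k -> V n -> Prop) :
  sa (fun w : V (k + n) => Q (lsubmx w) (rsubmx w)) ->
  sa (fun x => exists y, Q x y).
Proof.
elim: n k Q => [|n IH] k Q sQ.
  have /sa_poly_preimage : forall i, poly_fun
      (fun x : V k => row_mx x (0 : V 0) 0 i).
    by apply: poly_fun_row => [|[]//]; exact: poly_fun_coord.
  move=> /(_ _ sQ); apply: semialgebraic_ext => x.
  rewrite row_mxKl row_mxKr; split => [|[y]]; first by exists 0.
  by rewrite (thinmx0 y).
pose Q' (w : V (k + 1)) (y : V n) := Q (lsubmx w) (row_mx (rsubmx w) y : V n.+1).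
have /IH : sa (fun w : V (k + 1 + n) => Q' (lsubmx w) (rsubmx w)).
  have /sa_poly_preimage : forall i, poly_fun (fun w : V (k + 1 + n) =>
      row_mx (lsubmx (lsubmx w)) (row_mx (rsubmx (lsubmx w)) (rsubmx w)) 0 i).
    apply: poly_fun_row => i.
      have [p pE] := poly_fun_coord (lshift n (lshift 1 i)).
      by exists p => x; rewrite -pE !mxE.
    apply: poly_fun_row i => i; last exact: poly_fun_rsub.
    have [p pE] := poly_fun_coord (lshift n (rshift k i)).
    by exists p => x; rewrite -pE !mxE.
  by move=> /(_ _ sQ); apply: semialgebraic_ext => w; rewrite row_mxKl row_mxKr.
move=> /semialgebraic_proj; apply: semialgebraic_ext => x; rewrite /Q' /=.
split=> [[t [y]]|[y]].
  by rewrite row_mxKl row_mxKr; exists (row_mx (const_mx t : V 1) y).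
move=> Qy; exists (lsubmx (y : V (1 + n)) 0 0), (rsubmx (y : V (1 + n))).
rewrite row_mxKl row_mxKr.
rewrite (_ : row_mx _ _ = y :> V (1 + n))//.
rewrite -[RHS](@hsubmxK _ _ 1); congr row_mx.
by apply/rowP => i; rewrite ord1 mxE.
Qed.

Lemma sa_and k (A B : V k -> Prop) : sa A -> sa B -> sa (fun x => A x /\ B x).
Proof. exact: semialgebraicI. Qed.

Lemma sa_or k (A B : V k -> Prop) : sa A -> sa B -> sa (fun x => A x \/ B x).
Proof. exact: semialgebraicU. Qed.

Lemma sa_not k (A : V k -> Prop) : sa A -> sa (fun x => ~ A x).
Proof. exact: semialgebraicC. Qed.

Lemma sa_imp k (A B : V k -> Prop) : sa A -> sa B -> sa (fun x => A x -> B x).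
Proof.
move=> sA sB; apply: semialgebraic_ext (sa_or (sa_not sA) sB) => x.
split=> [[//|//]|h]; have [/h|] := pselect (A x); by [left|right].
Qed.

Lemma sa_all k (Q : V k -> R -> Prop) :
  sa (fun w : V (k + 1) => Q (lsubmx w) (rsubmx w 0 0)) ->
  sa (fun x => forall t, Q x t).
Proof.
move=> /sa_not/(@sa_ex _ (fun x t => ~ Q x t))/sa_not.
apply: semialgebraic_ext => x; split=> [h t|h [t]]; last exact.
by apply: contrapT => nQ; apply: h; exists t.
Qed.

Lemma sa_allv k n (Q : V k -> V n -> Prop) :
  sa (fun w : V (k + n) => Q (lsubmx w) (rsubmx w)) ->
  sa (fun x => forall y, Q x y).
Proof.
move=> /sa_not/(@sa_exv _ _ (fun x t => ~ Q x t))/sa_not.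
apply: semialgebraic_ext => x; split=> [h t|h [t]]; last exact.
by apply: contrapT => nQ; apply: h; exists t.
Qed.

Lemma sa_const k (P : Prop) : sa (fun _ : V k => P).
Proof.
have sT : sa (fun _ : V k => True).
  by apply: semialgebraic_ext (semialgebraic_eq0 0) => x /=; rewrite meval0.
have [p|np] := pselect P; first exact: semialgebraic_ext sT.
by apply: semialgebraic_ext (sa_not sT) => x; split => // nT; exfalso; exact: nT.
Qed.

Lemma sa_allfin k (I : finType) (Q : V k -> I -> Prop) :
  (forall i, sa (fun x => Q x i)) -> sa (fun x => forall i, Q x i).
Proof.
move=> sQ; apply: (@semialgebraic_ext _ _ (fun x => forall i, i \in enum I -> Q x i)).
  by move=> x; split=> h i //; apply: h; rewrite mem_enum.
elim: (enum I) => [|j s IH]; first by apply: semialgebraic_ext (sa_const _ True).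
apply: semialgebraic_ext (sa_and (sQ j) IH) => x; split=> [[Qj Qs] i|h].
  by rewrite inE => /predU1P[->|/Qs].
by split=> [|i si]; apply: h; rewrite inE ?eqxx ?si ?orbT.
Qed.

(** Functions are total, with an arbitrary value outside the set of interest,
    so that terms can be composed freely in formulas. *)
Definition sa_fun k (F : V k -> R) :=
  sa (fun w : V (k + 1) => F (lsubmx w) = rsubmx w 0 0).

Definition sa_map k n (F : V k -> V n) := forall i, sa_fun (fun x => F x 0 i).

Lemma sa_fun_poly k (F : V k -> R) : poly_fun F -> sa_fun F.
Proof.
move=> [p pE]; rewrite /sa_fun.
pose q := comp_mpoly [tuple mpolyX R (mnm1 (lshift 1 i)) | i < k] p.
pose r := mpolyX R (mnm1 (rshift k (0 : 'I_1))).
apply: semialgebraic_ext (semialgebraic_eq0 (q - r)) => w /=.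
rewrite mevalB comp_mpoly_meval mevalXU pE [in X in _ <-> X]mxE.
rewrite (@meval_eq _ _ _ ((lsubmx w) 0)) => [|i]; last first.
  by rewrite tnth_mktuple mevalXU mxE.
by split=> [/eqP|->]; rewrite ?subrr// subr_eq0 => /eqP.
Qed.

Lemma sa_fun_coord k (i : 'I_k) : sa_fun (fun x => x 0 i).
Proof. exact/sa_fun_poly/poly_fun_coord. Qed.

Lemma sa_map_id k : sa_map (fun x : V k => x).
Proof. by move=> i; exact: sa_fun_coord. Qed.

Lemma sa_fun_cst k (c : R) : sa_fun (fun _ : V k => c).
Proof. by apply: sa_fun_poly; exists (mpolyC k c) => x; rewrite mevalC. Qed.

Lemma sa_map_cst k n (c : V n) : sa_map (fun _ : V k => c).
Proof. by move=> i; exact: sa_fun_cst. Qed.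

Lemma sa_fun_poly_comp k n (F : V n -> R) (G : V k -> V n) :
  sa_fun F -> (forall i, poly_fun (fun x => G x 0 i)) -> sa_fun (fun x => F (G x)).
Proof.
move=> sF pG; rewrite /sa_fun.
have /sa_poly_preimage : forall i, poly_fun
    (fun w : V (k + 1) => row_mx (G (lsubmx w)) (rsubmx w) 0 i).
  apply: poly_fun_row => i; last exact: poly_fun_rsub.
  have [p pE] := pG i.
  exists (comp_mpoly [tuple mpolyX R (mnm1 (lshift 1 i)) | i < k] p) => w.
  rewrite pE comp_mpoly_meval; apply: meval_eq => j.
  by rewrite tnth_mktuple mevalXU mxE.
by move=> /(_ _ sF); apply: semialgebraic_ext => w; rewrite row_mxKl row_mxKr.
Qed.

Lemma sa_map_lsub j k n (F : V j -> V n) :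
  sa_map F -> sa_map (fun w : V (j + k) => F (lsubmx w)).
Proof. by move=> sF i; apply: sa_fun_poly_comp (sF i) _ => l; exact: poly_fun_lsub. Qed.

Lemma sa_fun_lsub j k (F : V j -> R) :
  sa_fun F -> sa_fun (fun w : V (j + k) => F (lsubmx w)).
Proof. by move=> sF; apply: sa_fun_poly_comp sF _ => l; exact: poly_fun_lsub. Qed.

Lemma sa_map_rsub j k : sa_map (fun w : V (j + k) => rsubmx w).
Proof. by move=> i; apply: sa_fun_poly; exact: poly_fun_rsub. Qed.

Lemma sa_fun_rsub j k i : sa_fun (fun w : V (j + k) => rsubmx w 0 i).
Proof. exact: sa_map_rsub. Qed.

(** The value of the term is named by a quantified vector, which reduces the
    claim to the graphs of the coordinates of [F]. *)
Lemma sa_pre k n (A : set (V n)) (F : V k -> V n) :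
  sa_map F -> sa A -> sa (fun x => A (F x)).
Proof.
move=> sF sA; apply: (@semialgebraic_ext _ _ (fun x => exists y : V n,
    (forall i, F x 0 i = y 0 i) /\ A y)).
  move=> x; split=> [[y [/rowP<-//]]|]; by exists (F x).
apply: sa_exv; apply: sa_and; last first.
  by apply: sa_poly_preimage sA => i; exact: poly_fun_rsub.
apply: sa_allfin => i.
have /sa_poly_preimage : forall j, poly_fun (fun w : V (k + n) =>
    row_mx (lsubmx w) (const_mx (rsubmx w 0 i) : V 1) 0 j).
  apply: poly_fun_row => j; first exact: poly_fun_lsub.
  have [p pE] := poly_fun_rsub k i.
  by exists p => x; rewrite -pE !mxE.
move=> /(_ _ (sF i)); apply: semialgebraic_ext => w.
by rewrite row_mxKl row_mxKr [in X in X <-> _]mxE.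
Qed.

Lemma sa_fun_comp k n (F : V n -> R) (G : V k -> V n) :
  sa_fun F -> sa_map G -> sa_fun (fun x => F (G x)).
Proof.
move=> sF sG; rewrite /sa_fun.
have /sa_pre : sa_map (fun w : V (k + 1) => row_mx (G (lsubmx w)) (rsubmx w)).
  move=> i; rewrite -[i]splitK; case: fintype.split => j /=.
    rewrite (_ : (fun _ => _) = fun w : V (k + 1) => G (lsubmx w) 0 j); last first.
      by apply/funext => w; rewrite row_mxEl.
    by apply: sa_fun_lsub (sG j).
  rewrite (_ : (fun _ => _) = fun w : V (k + 1) => rsubmx w 0 j); last first.
    by apply/funext => w; rewrite row_mxEr.
  exact: sa_fun_rsub.
by move=> /(_ _ sF); apply: semialgebraic_ext => w; rewrite row_mxKl row_mxKr.
Qed.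

Lemma sa_map_comp k j n (F : V n -> V j) (G : V k -> V n) :
  sa_map F -> sa_map G -> sa_map (fun x => F (G x)).
Proof. by move=> sF sG i; exact: (sa_fun_comp (sF i) sG). Qed.

Lemma sa_map_row k n1 n2 (F : V k -> V n1) (G : V k -> V n2) :
  sa_map F -> sa_map G -> sa_map (fun x => row_mx (F x) (G x)).
Proof.
move=> sF sG i; rewrite -[i]splitK; case: fintype.split => j /=.
  rewrite (_ : (fun _ => _) = fun x => F x 0 j) //.
  by apply/funext => w; rewrite row_mxEl.
rewrite (_ : (fun _ => _) = fun x => G x 0 j) //.
by apply/funext => w; rewrite row_mxEr.
Qed.

Lemma sa_map_const_mx k n (F : V k -> R) : sa_fun F ->
  sa_map (fun x => const_mx (F x) : V n).
Proof.
by move=> sF i; rewrite (_ : (fun _ => _) = F)//; apply/funext => x; rewrite mxE.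
Qed.

Lemma sa_fun_op k (p : mpoly (1 + 1) R) (F G : V k -> R) : sa_fun F -> sa_fun G ->
  sa_fun (fun x => meval ((row_mx (const_mx (F x)) (const_mx (G x)) : V (1 + 1)) 0) p).
Proof.
move=> sF sG; have sp : sa_fun (fun w : V (1 + 1) => meval (w 0) p).
  by apply: sa_fun_poly; exists p.
by apply: (sa_fun_comp sp); apply: sa_map_row; exact: sa_map_const_mx.
Qed.

Lemma sa_funD k (F G : V k -> R) : sa_fun F -> sa_fun G -> sa_fun (fun x => F x + G x).
Proof.
move=> sF /(sa_fun_op (mpolyX R (mnm1 (lshift 1 0)) + mpolyX R (mnm1 (rshift 1 0))) sF).
congr sa_fun; apply/funext => x.
by rewrite mevalD !mevalXU row_mxEl row_mxEr !mxE.
Qed.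

Lemma sa_funM k (F G : V k -> R) : sa_fun F -> sa_fun G -> sa_fun (fun x => F x * G x).
Proof.
move=> sF /(sa_fun_op (mpolyX R (mnm1 (lshift 1 0)) * mpolyX R (mnm1 (rshift 1 0))) sF).
congr sa_fun; apply/funext => x.
by rewrite mevalM !mevalXU row_mxEl row_mxEr !mxE.
Qed.

Lemma sa_funN k (F : V k -> R) : sa_fun F -> sa_fun (fun x => - F x).
Proof.
move=> /(sa_funM (sa_fun_cst k (-1))); congr sa_fun.
by apply/funext => x; rewrite mulN1r.
Qed.

Lemma sa_funB k (F G : V k -> R) : sa_fun F -> sa_fun G -> sa_fun (fun x => F x - G x).
Proof. by move=> sF sG; apply: sa_funD => //; exact: sa_funN. Qed.

Lemma sa_eq k (F G : V k -> R) : sa_fun F -> sa_fun G -> sa (fun x => F x = G x).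
Proof.
move=> sF sG; have sB := sa_map_const_mx (n := 1) (sa_funB sF sG).
apply: semialgebraic_ext (sa_pre sB (semialgebraic_eq0 (mpolyX R (mnm1 0)))) => x /=.
by rewrite mevalXU mxE; split=> [/eqP|->]; rewrite ?subrr// subr_eq0 => /eqP.
Qed.

Lemma sa_lt k (F G : V k -> R) : sa_fun F -> sa_fun G -> sa (fun x => F x < G x).
Proof.
move=> sF sG; have sB := sa_map_const_mx (n := 1) (sa_funB sG sF).
apply: semialgebraic_ext (sa_pre sB (semialgebraic_gt0 (mpolyX R (mnm1 0)))) => x /=.
by rewrite mevalXU mxE subr_gt0.
Qed.

Lemma sa_le k (F G : V k -> R) : sa_fun F -> sa_fun G -> sa (fun x => F x <= G x).
Proof.
move=> sF sG; apply: semialgebraic_ext (sa_not (sa_lt sG sF)) => x.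
by rewrite leNgt; split => /negP.
Qed.

Lemma sa_eqv k n (F G : V k -> V n) : sa_map F -> sa_map G -> sa (fun x => F x = G x).
Proof.
move=> sF sG; apply: (@semialgebraic_ext _ _ (fun x => forall i, F x 0 i = G x 0 i)).
  by move=> x; split=> [/rowP|->].
by apply: sa_allfin => i; apply: sa_eq.
Qed.

Lemma sa_mapB k n (F G : V k -> V n) : sa_map F -> sa_map G -> sa_map (fun x => F x - G x).
Proof.
move=> sF sG i; rewrite (_ : (fun _ => _) = fun x => F x 0 i - G x 0 i).
  exact: sa_funB.
by apply/funext => x; rewrite !mxE.
Qed.

Lemma sa_fun_def k (F : V k -> R) (Q : V k -> R -> Prop) :
  (forall x t, Q x t <-> F x = t) ->
  sa (fun w : V (k + 1) => Q (lsubmx w) (rsubmx w 0 0)) -> sa_fun F.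
Proof. by move=> QE; apply: semialgebraic_ext => w; exact: QE. Qed.

Lemma sa_fun_if k (A : V k -> Prop) (F G : V k -> R) :
  sa A -> sa_fun F -> sa_fun G -> sa_fun (fun x => if `[< A x >] then F x else G x).
Proof.
move=> sA sF sG; apply: (@sa_fun_def _ _ (fun x t =>
  (A x /\ F x = t) \/ (~ A x /\ G x = t))).
  move=> x t; case: asboolP => Ax; split; [by case=> -[]|by left|by case=> -[]|].
  by right.
have sAl : sa (fun w : V (k + 1) => A (lsubmx w)).
  by apply: (sa_pre (F := fun w : V (k + 1) => lsubmx w)) sA; apply: sa_map_lsub (@sa_map_id k).
by apply: sa_or; apply: sa_and => //; exact: sa_not.
Qed.

Lemma sa_fun_inv k (F : V k -> R) : sa_fun F -> sa_fun (fun x => (F x)^-1).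
Proof.
move=> sF; apply: (@sa_fun_def _ _ (fun x t =>
  (F x = 0 /\ t = 0) \/ (F x <> 0 /\ F x * t = 1))).
  move=> x t; have [->|/eqP Fx] := eqVneq (F x) 0.
    rewrite invr0; split=> [[[]//|[]//]|<-]; by left.
  split=> [[[]//|[_ e]]|<-].
    by apply: (mulfI (introN eqP Fx)); rewrite e mulfV//; exact/eqP.
  by right; rewrite mulfV//; exact/eqP.
have sFl := sa_fun_lsub 1 sF; have sr := @sa_fun_rsub k 1 0.
apply: sa_or; apply: sa_and.
- by apply: sa_eq => //; exact: sa_fun_cst.
- by apply: sa_eq => //; exact: sa_fun_cst.
- by apply: sa_not; apply: sa_eq => //; exact: sa_fun_cst.
- by apply: sa_eq; [exact: sa_funM|exact: sa_fun_cst].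
Qed.

Lemma sa_fun_max k (F G : V k -> R) : sa_fun F -> sa_fun G ->
  sa_fun (fun x => Num.max (F x) (G x)).
Proof.
move=> sF sG; rewrite (_ : (fun _ => _) = fun x => if `[< F x < G x >] then G x else F x).
  by apply: sa_fun_if => //; exact: sa_lt.
by apply/funext => x; case: asboolP; rewrite /Order.max; case: ifP.
Qed.

Lemma sa_fun_abs k (F : V k -> R) : sa_fun F -> sa_fun (fun x => `|F x|).
Proof.
move=> sF; rewrite (_ : (fun _ => _) = fun x => Num.max (F x) (- F x)).
  by apply: sa_fun_max => //; exact: sa_funN.
by apply/funext => x; rewrite maxr_absE opprK subrr add0r -mulr2n normrMn -(mulr_natr `|F x|) mulfK // pnatr_eq0.
Qed.

Lemma sa_fun_norm k n (F : V k -> V n) : sa_map F -> sa_fun (fun x => `|F x|).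
Proof.
move=> sF; rewrite (_ : (fun _ => _) =
    fun x => \big[Num.max/0]_(ij : 'I_1 * 'I_n) `|F x ij.1 ij.2|); last first.
  by apply/funext => x; rewrite -mx_normrE.
elim: (index_enum _) => [|i r IH].
  by under eq_fun do rewrite big_nil; exact: sa_fun_cst.
under eq_fun do rewrite big_cons; apply: sa_fun_max => //.
by apply: sa_fun_abs; rewrite ord1; apply: sF.
Qed.

(** Semialgebraic functions of one real variable, through the identification
    of the field with the space of vectors of length 1. *)
Definition sa_fun1 (u : R -> R) := sa_fun (fun w : V 1 => u (w 0 0)).
Definition sa_map1 n (c : R -> V n) := forall i, sa_fun1 (fun t => c t 0 i).

Lemma sa_fun_comp1 k (u : R -> R) (F : V k -> R) :
  sa_fun1 u -> sa_fun F -> sa_fun (fun x => u (F x)).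
Proof.
move=> su sF; have := sa_fun_comp su (sa_map_const_mx (n := 1) sF).
by congr sa_fun; apply/funext => x; rewrite mxE.
Qed.

Lemma sa_map_comp1 k n (c : R -> V n) (F : V k -> R) :
  sa_map1 c -> sa_fun F -> sa_map (fun x => c (F x)).
Proof. by move=> sc sF i; exact: sa_fun_comp1 (sc i) sF. Qed.

Lemma sa_andb k (b c : V k -> bool) : sa (fun x => b x : Prop) ->
  sa (fun x => c x : Prop) -> sa (fun x => b x && c x : Prop).
Proof.
move=> sb sc; apply: semialgebraic_ext (sa_and sb sc) => x.
by split=> [[-> ->]|/andP].
Qed.

Lemma sa_map_lsubmx k j n (F : V k -> V (j + n)) :
  sa_map F -> sa_map (fun w => lsubmx (F w)).
Proof.
move=> sF i; rewrite (_ : (fun _ => _) = fun w => F w 0 (lshift n i))//.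
by apply/funext => w; rewrite mxE.
Qed.

Lemma sa_map_rsubmx k j n (F : V k -> V (j + n)) :
  sa_map F -> sa_map (fun w => rsubmx (F w)).
Proof.
move=> sF i; rewrite (_ : (fun _ => _) = fun w => F w 0 (rshift j i))//.
by apply/funext => w; rewrite mxE.
Qed.

End Definability.

(** Recursion on a formula in the language of ordered fields whose atoms are
    semialgebraic sets and functions named in the context. The case of a
    constant comes before the syntactic ones, since a pattern for a constant
    function also matches terms in which the variable occurs. *)
Ltac sa_step :=
  cbv beta;
  first [exact: sa_const | exact: sa_fun_cst | exact: sa_map_cst |
  lazymatch goal with
  | |- sa_map1 _ => let i := fresh "i" in move=> i
  | |- sa_fun1 _ => rewrite /sa_fun1
  | |- semialgebraic (fun x => _ /\ _) => apply: sa_and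
  | |- semialgebraic (fun x => _ \/ _) => apply: sa_or
  | |- semialgebraic (fun x => ~ _) => apply: sa_not
  | |- semialgebraic (fun x => exists _, _) => first [apply: sa_ex | apply: sa_exv]
  | |- semialgebraic (fun x => is_true (_ && _)) => apply: sa_andb
  | |- semialgebraic (fun x => is_true (_ < _)) => apply: sa_lt
  | |- semialgebraic (fun x => is_true (_ <= _)) => apply: sa_le
  | |- semialgebraic (fun x => _ = _) => first [apply: sa_eq | apply: sa_eqv]
  | |- semialgebraic (fun x => forall _, _) =>
      first [apply: sa_imp | apply: sa_all | apply: sa_allv]
  | H : semialgebraic ?A |- semialgebraic (fun x => ?A (@?F x)) =>
      refine (sa_pre (F := F) _ H)
  | |- sa_fun (fun x => _ + - _) => apply: sa_funB
  | |- sa_fun (fun x => _ + _) => apply: sa_funD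
  | |- sa_fun (fun x => _ * _) => apply: sa_funM
  | |- sa_fun (fun x => - _) => apply: sa_funN
  | |- sa_fun (fun x => _^-1) => apply: sa_fun_inv
  | |- sa_fun (fun x => Order.max _ _) => apply: sa_fun_max
  | |- sa_fun (fun x => `|_|) => first [apply: sa_fun_abs | apply: sa_fun_norm]
  | H : sa_fun ?u |- sa_fun (fun x => ?u (@?F x)) => refine (sa_fun_comp (G := F) H _)
  | H : sa_fun1 ?u |- sa_fun (fun x => ?u (@?F x)) => refine (sa_fun_comp1 (F := F) H _)
  | |- sa_fun (fun x => fun_of_matrix (@?F x) _ ?i) =>
      rewrite ?ord1; refine ((_ : sa_map F) i)
  | |- sa_map (fun x => x) => exact: sa_map_id
  | |- sa_map (fun x => lsubmx _) => apply: sa_map_lsubmx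
  | |- sa_map (@lsubmx _ _ _ _) => exact: (sa_map_lsubmx (@sa_map_id _ _))
  | |- sa_map (@rsubmx _ _ _ _) => exact: (sa_map_rsubmx (@sa_map_id _ _))
  | |- sa_map (fun x => rsubmx _) => apply: sa_map_rsubmx
  | |- sa_map (fun x => row_mx _ _) => apply: sa_map_row
  | |- sa_map (fun x => const_mx _) => apply: sa_map_const_mx
  | |- sa_map (fun x => _ + - _) => apply: sa_mapB
  | H : sa_map ?c |- sa_map (fun x => ?c (@?F x)) => refine (sa_map_comp (G := F) H _)
  | H : sa_map1 ?c |- sa_map (fun x => ?c (@?F x)) => refine (sa_map_comp1 (F := F) H _)
  | H : ?P |- ?P => exact: H
  end].
Ltac sa := solve [repeat sa_step].

(** * Semialgebraic functions of one real variable *)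

Section OneVariable.
Variable R : realType.
Notation V n := 'rV[R]_n.
Notation sa A := (semialgebraic A).

Lemma nearRP (a : R) (P : R -> Prop) :
  (\forall t \near a^'+, P t) <-> exists2 d, 0 < d & forall t, a < t < a + d -> P t.
Proof.
split=> [|[d d0 dP]].
  rewrite /at_right near_withinE => /nbhs_ballP[d /= d0 dP]; exists d => // t.
  move=> /andP[at' td]; apply: dP => //=.
  by rewrite /ball/= distrC gtr0_norm ?subr_gt0// ltrBlDl.
near=> t; apply: dP; apply/andP; split; first by near: t; exact: nbhs_right_gt.
by near: t; apply: nbhs_right_lt; rewrite ltrDl.
Unshelve. all: by end_near. Qed.

Lemma poly_sign_right (q : {poly R}) (a : R) : q != 0 ->
  (\forall t \near a^'+, 0 < q.[t]) \/ (\forall t \near a^'+, q.[t] < 0).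
Proof.
move=> q0; have [k [r + ->]] := multiplicity_XsubC q a; rewrite q0 /= => ra.
have cr : r.[t] @[t --> a^'+] --> r.[a].
  by apply: cvg_at_right_filter; exact: continuous_horner.
have pX : \forall t \near a^'+, 0 < ('X - a%:P : {poly R}).[t] ^+ k.
  near=> t; rewrite !hornerE exprn_gt0// subr_gt0.
  by near: t; exact: nbhs_right_gt.
have [r0|r0|r0] := ltgtP r.[a] 0; last by move: ra; rewrite /root r0 eqxx.
  right; near=> t; rewrite hornerM horner_exp pmulr_llt0; first last.
    by near: t.
  by near: t; move/cvgr_lt: cr; exact.
left; near=> t; rewrite hornerM horner_exp pmulr_lgt0; first last.
  by near: t.
by near: t; move/cvgr_gt: cr; exact.
Unshelve. all: by end_near. Qed.

Lemma mpoly1_poly (p : mpoly 1 R) : exists q : {poly R},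
  forall w : V 1, meval (w 0) p = q.[w 0 0].
Proof.
elim/mpolyind: p => [|c m p _ _ [q qE]].
  by exists 0 => w; rewrite meval0 horner0.
exists (c *: 'X ^+ (m 0) + q) => w.
by rewrite mevalD mevalZ mevalX big_ord1 qE !hornerE.
Qed.

(** A polynomial in one variable has a constant sign just to the right of any
    point; boolean combinations of such sign conditions inherit the property. *)
Lemma sa_right_dichotomy (S : R -> Prop) (a : R) : sa (fun w : V 1 => S (w 0 0)) ->
  (\forall t \near a^'+, S t) \/ (\forall t \near a^'+, ~ S t).
Proof.
suff H (A : set (V 1)) : sa A -> (\forall t \near a^'+, A (const_mx t)) \/
    (\forall t \near a^'+, ~ A (const_mx t)).
  by move=> /H[] h; [left|right]; apply: filterS h => t; rewrite mxE.
elim=> {A} [p|p|A B _ IA _ IB|A B _ IA _ IB|A _ IA].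
- have [q qE] := mpoly1_poly p.
  have [q0|/(@poly_sign_right _ a)] := eqVneq q 0.
    by left; apply: nearW => t /=; rewrite qE q0 horner0.
  case=> h; right; apply: filterS h => t /= + /eqP; rewrite qE mxE.
    by move=> /gt_eqF->.
  by move=> /lt_eqF->.
- have [q qE] := mpoly1_poly p.
  have [q0|/(@poly_sign_right _ a)] := eqVneq q 0.
    by right; apply: nearW => t /=; rewrite qE q0 horner0 ltxx.
  case=> h; [left|right]; apply: filterS h => t /=; rewrite qE mxE //.
  by move=> /lt_gtF->.
- case: IA => [hA|hA]; first by left; apply: filterS hA => t; left.
  case: IB => [hB|hB]; first by left; apply: filterS hB => t; right.
  by right; apply: filterS2 hA hB => t nA nB [].
- case: IA => [hA|hA]; last by right; apply: filterS hA => t nA [/nA].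
  case: IB => [hB|hB]; last by right; apply: filterS hB => t nB [_ /nB].
  by left; apply: filterS2 hA hB.
- case: IA => [hA|hA]; [right|by left].
  by apply: filterS hA => t At; apply.
Qed.

(** The limit is the supremum of the numbers that the function eventually
    exceeds: by the dichotomy, it is eventually at most any larger number. *)
Lemma sa_fun1_right_limit (u : R -> R) (K a : R) : sa_fun1 u ->
  (\forall t \near a^'+, `|u t| <= K) -> cvg (u t @[t --> a^'+]).
Proof.
move=> su uK; pose L : set R := [set c | \forall t \near a^'+, c < u t].
have L0 : L (- K - 1).
  apply: filterS uK => t; rewrite ler_norml => /andP[+ _]; lra.
have LK : ubound L K.
  move=> c Lc; have [t /= [cu +]] := @filter_ex _ (at_right a) _ _ (filterI Lc uK).
  rewrite ler_norml => /andP[_]; lra.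
have hL : has_sup L by split; [exists (- K - 1)|exists K].
apply/cvg_ex; exists (sup L); apply/cvgrPdist_lt => e e0.
have [c Lc cs] := sup_adherent e0 hL.
have nL : ~ L (sup L + e / 2).
  move=> /(ub_le_sup (proj2 hL)); lra.
have : \forall t \near a^'+, ~ (sup L + e / 2 < u t).
  have [//|//] : (\forall t \near a^'+, sup L + e / 2 < u t) \/
     (\forall t \near a^'+, ~ (sup L + e / 2 < u t)).
  apply: sa_right_dichotomy; sa.
apply: filterS2 Lc => t cu /negP; rewrite -leNgt ltr_norml => us.
apply/andP; split; lra.
Qed.

(** Right limits exist everywhere, so intervals on which the oscillation is
    small are dense, and Baire's theorem applies. *)
Lemma sa_fun1_continuity_point (u : R -> R) (K a b : R) : sa_fun1 u ->
  (forall t, `|u t| <= K) -> a < b -> exists2 t, a < t < b & {for t, continuous u}.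
Proof.
move=> su uK ab.
pose U (k : nat) : set R := [set t | exists2 d, 0 < d & forall s s',
  `|t - s| < d -> `|t - s'| < d -> `|u s - u s'| < k.+1%:R^-1].
have [|||t /= [tab tU]] := @Baire _ (R : completeNormedModType R) U _ `]a, b[%classic _ _.
- move=> k; split.
    rewrite openE => t [d d0 dU]; apply/nbhs_ballP; exists (d / 2) => /=; first lra.
    move=> s; rewrite /ball/= => ts; exists (d / 2); first lra.
    move=> x y sx sy; apply: dU; rewrite -(subrK s t) -addrA;
      by rewrite (le_lt_trans (ler_normD _ _))//; lra.
  move=> O [t Ot] oO.
  have /cvg_ex[l ul] : cvg (u s @[s --> t^'+]).
    by apply: (sa_fun1_right_limit (K := K) su); exact: nearW.
  have k0 : 0 < k.+1%:R^-1 / 2 :> R by rewrite divr_gt0// invr_gt0.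
  have /nearRP[d d0 du] : \forall s \near t^'+, `|l - u s| < k.+1%:R^-1 / 2.
    by move/cvgrPdist_lt: ul; apply.
  have /nearRP[d' d'0 dO] : \forall s \near t^'+, O s.
    by apply: cvg_within; exact: open_nbhs_nbhs.
  pose m := Num.min d d'; have m0 : 0 < m by rewrite lt_min d0.
  have [md md'] : m <= d /\ m <= d' by rewrite /m !ge_min !lexx orbT.
  exists (t + m / 2); split; first by apply: dO; apply/andP; split; lra.
  exists (m / 2) => [|s s']; first lra.
  rewrite !ltr_norml => /andP[s1 s2] /andP[s1' s2'].
  have /du h : t < s < t + d by apply/andP; split; lra.
  have /du h' : t < s' < t + d by apply/andP; split; lra.
  move: (k.+1%:R^-1) h h' => r; rewrite !ltr_norml => /andP[? ?] /andP[? ?].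
  by apply/andP; split; lra.
- by exists ((a + b) / 2) => /=; rewrite in_itv /=; apply/andP; split; lra.
- exact: itv_open.
exists t; first by move: tab; rewrite /= in_itv.
apply/cvgrPdist_lt => e e0.
pose k := Num.truncn e^-1.
have ke : k.+1%:R^-1 < e.
  rewrite invf_plt ?posrE//; exact: truncnS_gt.
have [d d0 dU] := tU k Logic.I.
near=> s; apply: (lt_trans _ ke); apply: dU; first by rewrite subrr normr0.
by near: s; apply/nbhs_ballP; exists d.
Unshelve. all: by end_near. Qed.

(** Continuity at a point is a first-order condition on the point, so just to
    the right of [a] it holds everywhere or nowhere. *)
Lemma sa_fun1_right_continuous (u : R -> R) (K a : R) : sa_fun1 u ->
  (forall t, `|u t| <= K) -> \forall t \near a^'+, {for t, continuous u}.
Proof.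
move=> su uK; pose C t := forall e, 0 < e -> exists d, 0 < d /\
  forall s, `|t - s| < d -> `|u t - u s| < e.
have CE t : C t -> {for t, continuous u}.
  move=> Ct; apply/cvgrPdist_lt => e /Ct[d [d0 dU]].
  by apply/nbhs_ballP; exists d.
have [h|/nearRP[d d0 dC]] : (\forall t \near a^'+, C t) \/ (\forall t \near a^'+, ~ C t).
- by apply: sa_right_dichotomy; rewrite /C; sa.
- exact: filterS h.
have [|t tad ct] := sa_fun1_continuity_point su uK (_ : a < a + d); first by rewrite ltrDl.
case: (dC t tad) => e /((cvgrPdist_lt _ _).1 ct _)/nbhs_ballP[r /= r0 rU].
by exists r; split.
Qed.

End OneVariable.

(** * Continuity on a subset *)

Section Continuity.
Variable R : realType.
Notation V n := 'rV[R]_n.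

(** The pointwise form of continuity within a subset, to which the rules on
    limits apply directly. *)
Definition cont_on (U W : pseudoMetricNormedZmodType R) (A : set U) (f : U -> W) :=
  forall x, A x -> f y @[y --> within A (nbhs x)] --> f x.

Lemma near_within_ball (U : pseudoMetricNormedZmodType R) (A : set U) x (P : U -> Prop) :
  (\forall y \near within A (nbhs x), P y) <->
  exists2 d : R, 0 < d & forall y, A y -> `|x - y| < d -> P y.
Proof.
rewrite near_withinE; split=> [/nbhs_ballP[d /= d0 dP]|[d d0 dP]].
  by exists d => // y Ay xy; apply: dP => //; rewrite -ball_normE.
by apply/nbhs_ballP; exists d => //= y; rewrite -ball_normE => xy Ay; exact: dP.
Qed.

Lemma cont_onP (U W : pseudoMetricNormedZmodType R) (A : set U) (f : U -> W) :
  cont_on A f <-> forall x, A x -> forall e : R, 0 < e ->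
    exists2 d : R, 0 < d & forall y, A y -> `|x - y| < d -> `|f x - f y| < e.
Proof.
split=> cf x Ax.
  by move=> e e0; apply/near_within_ball; move/cvgrPdist_lt: (cf x Ax); exact.
by apply/cvgrPdist_lt => e e0; apply/near_within_ball; exact: cf.
Qed.

Lemma cont_onW (U W : pseudoMetricNormedZmodType R) (A B : set U) (f : U -> W) :
  A `<=` B -> cont_on B f -> cont_on A f.
Proof.
move=> AB /cont_onP cf; apply/cont_onP => x Ax e e0.
have [d d0 dU] := cf x (AB x Ax) e e0.
by exists d => // y /AB By; exact: dU.
Qed.

Lemma cont_on_eq (U W : pseudoMetricNormedZmodType R) (A : set U) (f g : U -> W) :
  (forall x, A x -> f x = g x) -> cont_on A f -> cont_on A g.
Proof.
move=> fg /cont_onP cf; apply/cont_onP => x Ax e e0.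
have [d d0 dU] := cf x Ax e e0.
by exists d => // y Ay xy; rewrite -!fg//; exact: dU.
Qed.

Lemma cont_on_comp (U W Z : pseudoMetricNormedZmodType R) (A : set U) (B : set W)
    (f : U -> W) (g : W -> Z) : (forall x, A x -> B (f x)) ->
  cont_on A f -> cont_on B g -> cont_on A (g \o f).
Proof.
move=> AB /cont_onP cf /cont_onP cg; apply/cont_onP => x Ax e e0.
have [d d0 dU] := cg _ (AB x Ax) e e0.
have [r r0 rU] := cf _ Ax d d0.
by exists r => // y Ay xy; apply: dU; [exact: AB|exact: rU].
Qed.

Lemma cont_on_within (U W : pseudoMetricNormedZmodType R) (A : set U) (f : U -> W) :
  cont_on A f <-> {within A, continuous f}.
Proof. by rewrite subspace_continuousP. Qed.

Lemma cont_on_sig (U W : pseudoMetricNormedZmodType R) (A : set U) (F : U -> W)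
  (f : A -> W) : (forall x : A, f x = F (set_val x)) -> continuous f <-> cont_on A F.
Proof.
move=> fF; rewrite cont_on_within subspace_sigL_continuousP.
by rewrite (_ : sigL A F = f)//; apply/funext => x; rewrite fF.
Qed.

Lemma set_val_continuous (U : pseudoMetricNormedZmodType R) (A : set U) :
  continuous (@set_val _ A).
Proof. exact: initial_continuous. Qed.

Lemma continuous_set_val (T : topologicalType) (W : pseudoMetricNormedZmodType R)
    (B : set W) (f : T -> B) : continuous f <-> continuous (fun x => set_val (f x)).
Proof.
split=> cf; last exact: (@continuous_comp_initial _ _ _ (@set_val _ B)).
by move=> x; apply: continuous_comp (cf x) _; exact: set_val_continuous.
Qed.

Lemma ltr_norm_rV n (x : V n) (e : R) : 0 < e -> (forall i, `|x 0 i| < e) -> `|x| < e.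
Proof.
move=> e0 xe; rewrite [ltLHS]/Num.Def.normr /= mx_normrE; apply/bigmax_ltP; split=> //.
by move=> [i j] _ /=; rewrite ord1.
Qed.

Lemma ler_coord_norm n (x : V n) i : `|x 0 i| <= `|x|.
Proof.
rewrite [leRHS]/Num.Def.normr /= mx_normrE; apply/bigmax_geP; right => /=.
by exists (0, i).
Qed.

Lemma cont_on_rV (U : pseudoMetricNormedZmodType R) (A : set U) n (f : U -> V n) :
  (forall i, cont_on A (fun x => f x 0 i)) -> cont_on A f.
Proof.
move=> cf x Ax; apply/cvgrPdist_lt => e e0.
have : \forall y \near within A (nbhs x), forall i, `|f x 0 i - f y 0 i| < e.
  apply: filter_forall => i; move/cvgrPdist_lt: (cf i x Ax); exact.
by apply: filterS => y h; apply: ltr_norm_rV => // i; rewrite !mxE; exact: h.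
Qed.

Lemma cont_on_coord (U : pseudoMetricNormedZmodType R) (A : set U) n (f : U -> V n) i :
  cont_on A f -> cont_on A (fun x => f x 0 i).
Proof.
move=> /cont_onP cf; apply/cont_onP => x Ax e e0.
have [d d0 dU] := cf x Ax e e0; exists d => // y Ay xy.
apply: le_lt_trans (dU y Ay xy).
by have := ler_coord_norm (f x - f y) i; rewrite !mxE.
Qed.

Lemma cont_on_cst (U W : pseudoMetricNormedZmodType R) (A : set U) (c : W) :
  cont_on A (fun _ => c).
Proof. by move=> x _; exact: cvg_cst. Qed.

Lemma cont_on_id (U : pseudoMetricNormedZmodType R) (A : set U) :
  cont_on A (fun x => x).
Proof. by apply/cont_onP => x _ e e0; exists e. Qed.

Lemma cont_onD (U : pseudoMetricNormedZmodType R) (W : normedModType R) (A : set U)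
  (f g : U -> W) : cont_on A f -> cont_on A g -> cont_on A (fun x => f x + g x).
Proof. by move=> cf cg x Ax; apply: cvgD; [exact: cf|exact: cg]. Qed.

Lemma cont_onB (U : pseudoMetricNormedZmodType R) (W : normedModType R) (A : set U)
  (f g : U -> W) : cont_on A f -> cont_on A g -> cont_on A (fun x => f x - g x).
Proof. by move=> cf cg x Ax; apply: cvgB; [exact: cf|exact: cg]. Qed.

Lemma cont_onM (U : pseudoMetricNormedZmodType R) (A : set U)
  (f g : U -> R) : cont_on A f -> cont_on A g -> cont_on A (fun x => f x * g x).
Proof. by move=> cf cg x Ax; apply: cvgM; [exact: cf|exact: cg]. Qed.

Lemma cont_on_inv (U : pseudoMetricNormedZmodType R) (A : set U)
  (f : U -> R) : (forall x, A x -> f x != 0) -> cont_on A f ->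
  cont_on A (fun x => (f x)^-1).
Proof. by move=> f0 cf x Ax; apply: cvgV; [exact: f0|exact: cf]. Qed.

Lemma cont_on_norm (U : pseudoMetricNormedZmodType R) (W : normedModType R) (A : set U)
  (f : U -> W) : cont_on A f -> cont_on A (fun x => `|f x| : R).
Proof. by move=> cf x Ax; apply: cvg_norm; exact: cf. Qed.

Lemma cont_on_max (U : pseudoMetricNormedZmodType R) (A : set U)
  (f g : U -> R) : cont_on A f -> cont_on A g -> cont_on A (fun x => Num.max (f x) (g x)).
Proof.
move=> cf cg; apply: (cont_on_eq (f := fun x => (f x + g x + `|f x - g x|) / 2)).
  by move=> x _; rewrite maxr_absE.
apply: (@cont_onM _ _ (fun x => f x + g x + `|f x - g x|) (fun=> 2^-1)); last exact: cont_on_cst.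
apply: cont_onD.
  exact: cont_onD.
by apply: cont_on_norm; exact: cont_onB.
Qed.

Lemma cont_on_dense_eq (U : pseudoMetricNormedZmodType R) (A B : set U)
    (f g : U -> R) : B `<=` A -> cont_on A f -> cont_on A g ->
  (forall x (e : R), A x -> 0 < e -> exists2 y, B y & `|x - y| < e) ->
  (forall y, B y -> f y = g y) -> forall x, A x -> f x = g x.
Proof.
move=> BA cf cg dB fg x Ax.
have /cont_onP ch := cont_onB cf cg.
apply/eqP; rewrite -subr_eq0; apply/negPn/negP => h0.
have e0 : 0 < `|f x - g x| by rewrite normr_gt0.
have [d d0 dU] := ch x Ax _ e0.
have [y By xy] := dB x d Ax d0.
by have := dU y (BA y By) xy; rewrite (fg y By) (subrr (g y)) subr0 ltxx.
Qed.

End Continuity.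

(** * Ends of a semialgebraic set *)

Section Ends.
Variable R : realType.
Notation V n := 'rV[R]_n.
Notation sa A := (semialgebraic A).

(** First-order counterpart of [eta_set]; spheres are for the sup norm. *)
Definition sphere_end n (X : set (V n)) : set (V n) := fun p =>
  X p /\ exists d : R, 0 < d /\ forall e : R, 0 < e < d ->
    exists x, (X x /\ `|p - x| = e) /\ forall y, X y /\ `|p - y| = e -> y = x.

Lemma sa_sphere_end n (X : set (V n)) : sa X -> sa (sphere_end X).
Proof. by move=> sX; rewrite /sphere_end; sa. Qed.

Definition I01 : set R := fun t => 0 <= t < 1.

(** By the last condition the initial pieces of the arc are neighborhoods of
    its end in [X]; farther from the end, [X] may contain other points close to
    the arc. *)
Record end_arc n (X : set (V n)) (p : V n) (c : R -> V n) : Prop := Arc {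
  arc_sa : sa_map1 c;
  arc0 : c 0 = p;
  arc_in : forall t, I01 t -> X (c t);
  arc_cont : cont_on I01 c;
  arc_inj : forall s t, I01 s -> I01 t -> c s = c t -> s = t;
  arc_nbhs : forall d : R, 0 < d -> exists2 r : R, 0 < r & forall x, X x ->
    `|p - x| < r -> exists2 t, I01 t /\ t < d & c t = x }.

Lemma I01_0 : I01 0. Proof. by rewrite /I01 lexx ltr01. Qed.

(** The point of X at distance e from p is a bounded semialgebraic function of
    e, hence continuous for small e. *)
Lemma radial_arc n (X : set (V n)) p : sa X -> sphere_end X p ->
  exists r c, [/\ 0 < r, end_arc X p c, forall t, I01 t -> `|p - c t| = r * t &
    forall x, X x -> `|p - x| < r -> exists2 t, I01 t & c t = x].
Proof.
move=> sX [Xp [d [d0 dX]]].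
have /choice[g gE] : forall e, exists x, if `[< 0 < e < d >] then
    (X x /\ `|p - x| = e) /\ (forall y, X y /\ `|p - y| = e -> y = x) else x = p.
  by move=> e; case: asboolP => [/dX//|_]; exists p.
have gin e : 0 < e < d -> [/\ X (g e), `|p - g e| = e &
    forall y, X y -> `|p - y| = e -> y = g e].
  move=> ed; have := gE e; case: asboolP => // _ [[Xg ge] gu]; split=> // y Xy py.
  by apply: gu.
have gout e : ~ (0 < e < d) -> g e = p.
  by move=> ed; have := gE e; case: asboolP.
have g0 : g 0 = p by apply: gout; rewrite ltxx.
have sg : sa_map1 g.
  move=> i; apply: (@sa_fun_def _ _ _ (fun w s => ((0 < w 0 0 < d) /\
      exists x, X x /\ `|p - x| = w 0 0 /\ x 0 i = s) \/
      (~ (0 < w 0 0 < d) /\ p 0 i = s))); last by sa.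
  move=> w s; set e := w 0 0; split.
    case=> [[/gin[Xg ge gu]]|[/gout-> //]].
    by case=> x [Xx [px <-]]; rewrite (gu x).
  move=> <-; have [/[dup] ed /gin[Xg ge gu]|nd] := pselect (0 < e < d).
    by left; split=> //; exists (g e).
  by right; rewrite gout.
have gb e : `|g e| <= `|p| + d.
  have [/[dup] ed /gin[Xg ge gu]|/gout->] := pselect (0 < e < d); last lra.
  rewrite -(subrK p (g e)) addrC (le_trans (ler_normD _ _))// lerD2l distrC ge.
  by case/andP: ed => _ /ltW.
have : \forall t \near 0^'+, forall i, {for t, continuous (fun t => g t 0 i)}.
  apply: filter_forall => i; apply: (sa_fun1_right_continuous (K := `|p| + d)).
    exact: sg.
  by move=> t; exact: le_trans (ler_coord_norm _ _) (gb t).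
move=> /nearRP[d' d'0 dc].
pose r := Num.min d d'; have r0 : 0 < r by rewrite lt_min d0.
have [rd rd'] : r <= d /\ r <= d' by rewrite /r !ge_min !lexx orbT.
have rt t : I01 t -> t = 0 \/ 0 < r * t < d.
  move=> /andP[t0 t1]; have [->|nt0] := eqVneq t 0; first by left.
  have t0' : 0 < t by rewrite lt_neqAle eq_sym nt0.
  by right; rewrite mulr_gt0//= (lt_le_trans _ rd)// gtr_pMr.
have gr t : I01 t -> `|p - g (r * t)| = r * t.
  by move=> /rt[->|/gin[]//]; rewrite mulr0 g0 subrr normr0.
have loc x : X x -> `|p - x| < r -> I01 (`|p - x| / r) /\ g (r * (`|p - x| / r)) = x.
  move=> Xx xr; split.
    by rewrite /I01 divr_ge0 ?(ltW r0)// ltr_pdivrMr// mul1r.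
  rewrite mulrC divfK ?gt_eqF//; have [p0|pn0] := eqVneq `|p - x| 0.
    by rewrite p0 g0; apply/eqP; rewrite -subr_eq0 -normr_eq0 p0.
  have /gin[_ _ gu] : 0 < `|p - x| < d.
    by rewrite lt_neqAle eq_sym pn0 normr_ge0/= (lt_le_trans xr).
  exact/esym/gu.
exists r, (fun t => g (r * t)); split=> //; last first.
  by move=> x Xx /(loc x Xx)[? ?]; exists (`|p - x| / r).
split.
- have sid : sa_fun1 (fun t : R => r * t) by sa.
  move=> i; rewrite /sa_fun1; sa.
- by rewrite mulr0.
- by move=> t /rt[->|/gin[]//]; rewrite mulr0 g0.
- move=> t It; have [->|/andP[rt0 rtd]] := rt t It.
    apply/cvgrPdist_lt => e e0; apply/near_within_ball; exists (e / r).
      by rewrite divr_gt0.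
    move=> s Is; rewrite mulr0 g0 gr// sub0r normrN ger0_norm; last by case/andP: Is.
    by rewrite ltr_pdivlMr// mulrC.
  apply/cvgrPdist_lt => e e0.
  have : \forall s \near within I01 (nbhs t), forall i,
      `|g (r * t) 0 i - g (r * s) 0 i| < e.
    apply: filter_forall => i.
    have ct : {for t, continuous (fun s => g (r * s) 0 i)}.
      apply: (continuous_comp (f := fun s : R => r * s) (g := fun s => g s 0 i)).
        exact: mulrl_continuous.
      apply: dc; rewrite add0r rt0/=; apply: lt_le_trans rd'.
      by rewrite gtr_pMr; case/andP: It.
    by apply: cvg_within; move/cvgrPdist_lt: ct; exact.
  by apply: filterS => s h; apply: ltr_norm_rV => // i; rewrite !mxE; exact: h.
- move=> s t Is It gst; have := gr s Is; rewrite gst gr// => /mulfI h.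
  by apply/esym/h; rewrite gt_eqF.
- move=> e e0; exists (r * Num.min e 1); first by rewrite mulr_gt0// lt_min e0 ltr01.
  move=> x Xx; rewrite mulrC -ltr_pdivrMr// lt_min => /andP[xe].
  rewrite ltr_pdivrMr// mul1r => /(loc x Xx)[Ix xE].
  by exists (`|p - x| / r).
Qed.

(** A continuous function that can always be increased by moving slightly to
    the right attains its maximum over a segment at the right end only. *)
Lemma right_increasing (f : R -> R) (a b : R) : {within `[a, b], continuous f} ->
  (forall s, a <= s < b -> exists2 s', s < s' <= b & f s < f s') ->
  forall s, a <= s < b -> f s < f b.
Proof.
move=> cf inc s /andP[sa sb].
have [|m mab mmax] := EVT_max _ cf; first lra.
have mb : m = b.
  apply/eqP; rewrite eq_le; move: (mab); rewrite in_itv/= => /andP[am ->]/=.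
  rewrite leNgt; apply/negP => mb.
  have [|m' /andP[mm' m'b] fm] := inc m; first by rewrite am mb.
  have := mmax m'; rewrite in_itv/= m'b (le_trans am (ltW mm')) => /(_ isT).
  by rewrite leNgt fm.
have [|s' /andP[ss' s'b] fs] := inc s; first by rewrite sa.
apply: (lt_le_trans fs); rewrite -mb; apply: mmax.
by rewrite in_itv/= s'b andbT; lra.
Qed.

End Ends.

Section Arcs.
Variable R : realType.
Notation V n := 'rV[R]_n.
Notation sa A := (semialgebraic A).
Notation I01 := (@I01 R).

Lemma cont_on_segment (W : normedModType R) (f : R -> W) (a b : R) : cont_on I01 f ->
  0 <= a -> b < 1 -> {within `[a, b], continuous f}.
Proof.
move=> cf a0 b1; apply/cont_on_within; apply: cont_onW cf => t /=.
by rewrite in_itv/= /I01 => /andP[at' tb]; apply/andP; split; lra.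
Qed.

Lemma cont_dist (W : normedModType R) (q : W) (A : set R) (c : R -> W) :
  cont_on A c -> cont_on A (fun t => `|q - c t|).
Proof.
by move=> cc; apply: cont_on_norm; apply: cont_onB => //; exact: cont_on_cst.
Qed.

Lemma arc_dist_gt0 n (X : set (V n)) p c t : end_arc X p c -> 0 < t < 1 -> 0 < `|p - c t|.
Proof.
move=> ac /andP[t0 t1]; rewrite normr_gt0 subr_eq0 -(arc0 ac); apply/eqP.
move=> /(arc_inj ac (I01_0 R)); rewrite /I01 (ltW t0) t1 => /(_ isT) t0'.
by rewrite -t0' ltxx in t0.
Qed.

(** By the dichotomy the distance to the end of an arc is, near that end,
    either increasable at every parameter or at none. The second case would
    keep it away from 0. *)
Lemma arc_dist_increasing n (X : set (V n)) p c : end_arc X p c -> exists2 d : R,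
  0 < d < 1 & forall s t, 0 < s < t -> t < d -> `|p - c s| < `|p - c t|.
Proof.
move=> ac; pose u t : R := `|p - c t|.
have cu : cont_on I01 u by apply: cont_dist; exact: arc_cont ac.
have su : sa_fun1 u by have sc := arc_sa ac; rewrite /u; sa.
pose S t := exists d, 0 < d /\ forall s, t < s < t + d -> u t < u s.
have [|h] : (\forall t \near 0^'+, S t) \/ (\forall t \near 0^'+, ~ S t).
- by apply: sa_right_dichotomy; rewrite /S; sa.
- move=> /nearRP[d d0 dS]; exists (Num.min d (1/2)).
    by rewrite lt_min d0 gt_min; apply/andP; split; [|apply/orP; right]; lra.
  move=> s t /andP[s0 st]; rewrite lt_min => /andP[td t1].
  have t1' : t < 1 by lra.
  apply: (right_increasing (cont_on_segment (a := s) cu (ltW s0) t1')); last first.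
    by rewrite lexx.
  move=> x /andP[sx xt]; have [|e [e0 ex]] := dS x; first by apply/andP; split; lra.
  exists (Num.min t (x + e / 2)).
    by rewrite lt_min xt ge_min lexx ltrDl divr_gt0.
  apply: ex; rewrite lt_min xt ltrDl divr_gt0// gt_min; apply/orP; right; lra.
case: notF; move: h => /nearRP[d d0 dS].
pose b := Num.min (d / 2) (1 / 2).
have [b0 bd b1] : [/\ 0 < b, b < d & b < 1].
  split; first by rewrite lt_min; apply/andP; split; lra.
    by rewrite gt_min; apply/orP; left; lra.
  by rewrite gt_min; apply/orP; right; lra.
have ub0 : 0 < u b by apply: (arc_dist_gt0 ac); rewrite b0.
(* Where u never increases to the right, k * t - u t is increasing for every
   k > 0. With k * b = u b / 2 its value at b is - u b / 2, which is less than
   its value at a as soon as u a < u b / 2. *)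
pose k := u b / (2 * b).
have k0 : 0 < k by rewrite divr_gt0// mulr_gt0.
have kb : k * b = u b / 2 by rewrite /k; field; rewrite gt_eqF.
have ub2 : 0 < u b / 2 by rewrite divr_gt0.
have [r r0 ru] := (cont_onP _ _).1 cu 0 (I01_0 R) (u b / 2) ub2.
pose a := Num.min (r / 2) (b / 2).
have [a0 ar ab] : [/\ 0 < a, a < r & a < b].
  split; first by rewrite lt_min; apply/andP; split; lra.
    by rewrite gt_min; apply/orP; left; lra.
  by rewrite gt_min; apply/orP; right; lra.
have ua : u a < u b / 2.
  have := ru a; rewrite {1}/I01 (ltW a0) (lt_trans ab b1) => /(_ isT).
  rewrite sub0r normrN gtr0_norm// => /(_ ar).
  by rewrite {1}/u (arc0 ac) subrr normr0 sub0r normrN ger0_norm ?normr_ge0 //; apply: normr_ge0.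
have cw : {within `[a, b], continuous (fun t => k * t - u t)}.
  apply: cont_on_segment (ltW a0) b1; apply: cont_onB => //.
  by apply: cont_onM; [exact: cont_on_cst|exact: cont_on_id].
have /(right_increasing cw) H : forall s, a <= s < b ->
    exists2 s', s < s' <= b & k * s - u s < k * s' - u s'.
  move=> s /andP[as' sb].
  have [h|/nearRP[e e0 ne]] : (\forall s' \near s^'+, u s < u s') \/
      (\forall s' \near s^'+, ~ u s < u s').
  - by apply: sa_right_dichotomy; sa.
  - have [|] := dS s; first by apply/andP; split; lra.
    by move/nearRP: h => [e e0 eS]; exists e.
  pose s' := Num.min b (s + e / 2).
  have [ss' s'b s'e] : [/\ s < s', s' <= b & s' < s + e].
    split; first by rewrite lt_min sb ltrDl divr_gt0.
      by rewrite ge_min lexx.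
    by rewrite gt_min; apply/orP; right; lra.
  exists s'; first by rewrite ss'.
  have /ne/negP : s < s' < s + e by rewrite ss'.
  rewrite -leNgt => us; have := ltr_pM2l k0 s s'; rewrite ss'; lra.
have := H a; rewrite lexx ab => /(_ isT); rewrite kb.
have : 0 < k * a by exact: mulr_gt0.
lra.
Qed.

(** Along the arc the distance to p takes each small positive value: at least
    once by the intermediate value theorem, at most once by monotonicity. *)
Lemma arc_sphere_end n (X : set (V n)) p c : end_arc X p c -> sphere_end X p.
Proof.
move=> ac; have [d /andP[d0 d1] inc] := arc_dist_increasing ac.
split; first by rewrite -(arc0 ac); apply: (arc_in ac); exact: (I01_0 R).
have [r r0 rX] := arc_nbhs ac d0.
pose b := d / 2.
have [b0 bd] : 0 < b /\ b < d by rewrite /b; split; lra.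
have ub0 : 0 < `|p - c b| by apply: (arc_dist_gt0 ac); apply/andP; split; lra.
exists (Num.min r `|p - c b|); split; first by rewrite lt_min r0.
move=> e /andP[e0]; rewrite lt_min => /andP[er eb].
have cu := cont_dist (q := p) (arc_cont ac).
have [t tb te] : exists2 t, t \in `[0, b] & `|p - c t| = e.
  apply: IVT (ltW b0) (cont_on_segment cu (lexx _) (lt_trans bd d1)) _.
  by rewrite (arc0 ac) subrr normr0 ge_min le_max (ltW e0) (ltW eb) orbT.
move: tb; rewrite in_itv/= => /andP[t0 tb].
have It : I01 t by apply/andP; split; lra.
exists (c t); split; first by split=> //; exact: arc_in ac t It.
move=> y [Xy py]; have [|s [Is sd] cs] := rX y Xy; first by rewrite py.
rewrite -cs; congr c; rewrite -cs in py; case/andP: Is => s0 s1.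
have t0' : 0 < t.
  by rewrite lt_neqAle t0 andbT; apply/eqP => t0'; move: te e0;
    rewrite -t0' (arc0 ac) subrr normr0 => <-; rewrite ltxx.
have s0' : 0 < s.
  by rewrite lt_neqAle s0 andbT; apply/eqP => s0'; move: py e0;
    rewrite -s0' (arc0 ac) subrr normr0 => <-; rewrite ltxx.
have [st|ts|//] := ltgtP s t.
  by have := inc s t; rewrite s0' st (le_lt_trans tb bd) py te ltxx => /(_ isT isT).
by have := inc t s; rewrite t0' ts sd py te ltxx => /(_ isT isT).
Qed.

(** On both sides of an interior point the arc crosses every small sphere
    centered at that point. *)
Lemma arc_interior n (X : set (V n)) p c t : end_arc X p c -> 0 < t < 1 ->
  ~ sphere_end X (c t).
Proof.
move=> ac /andP[t0 t1] [_ [d [d0 dX]]].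
pose v s := `|c t - c s|.
have v0 s : 0 <= s < 1 -> s != t -> 0 < v s.
  move=> Is st; rewrite normr_gt0 subr_eq0; apply/eqP => /(arc_inj ac) ts.
  by move: st; rewrite -ts ?eqxx// /I01 (ltW t0).
pose a := t / 2; pose b := (t + 1) / 2.
have [a0 at' tb b1] : [/\ 0 < a, a < t, t < b & b < 1] by rewrite /a/b; split; lra.
have va : 0 < v a by apply: v0; [apply/andP; split|rewrite lt_eqF]; lra.
have vb : 0 < v b by apply: v0; [apply/andP; split|rewrite gt_eqF]; lra.
pose m := Num.min d (Num.min (v a) (v b)).
have m0 : 0 < m by rewrite !lt_min d0 va.
have [md [ma mb]] : m <= d /\ m <= v a /\ m <= v b.
  by rewrite /m !ge_min !lexx !orbT.
pose e := m / 2; have [e0 em] : 0 < e /\ e < m by rewrite /e; split; lra.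
have [|x [_ xu]] := dX e; first by apply/andP; split; lra.
have cv := cont_dist (q := c t) (arc_cont ac).
have vt : v t = 0 by rewrite /v subrr normr0.
have [s sI ve] : exists2 s, s \in `[a, t] & v s = e.
  apply: IVT (ltW at') (cont_on_segment cv (ltW a0) t1) _.
  by rewrite -/(v a) -/(v t) vt ge_min le_max; apply/andP; split; apply/orP; [right|left]; lra.
have [s' sI' ve'] : exists2 s, s \in `[t, b] & v s = e.
  apply: IVT (ltW tb) (cont_on_segment cv (ltW t0) b1) _.
  by rewrite -/(v b) -/(v t) vt ge_min le_max; apply/andP; split; apply/orP; [left|right]; lra.
move: sI sI'; rewrite !in_itv/= => /andP[s1 s2] /andP[s1' s2'].
have Is : I01 s by apply/andP; split; lra.
have Is' : I01 s' by apply/andP; split; lra.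
have : c s = c s'.
  have -> : c s = x by apply: xu; split; [exact: arc_in ac s Is|exact: ve].
  by apply/esym; apply: xu; split; [exact: arc_in ac s' Is'|exact: ve'].
move=> /(arc_inj ac Is Is') ss'.
have st : s = t by lra.
by move: ve; rewrite st vt; lra.
Qed.

End Arcs.

(** * Points at which bounded functions have limits *)

Section Oscillation.
Variable R : realType.
Notation V n := 'rV[R]_n.
Notation sa A := (semialgebraic A).

Lemma sa_fun_sup k (Q : V k -> R -> Prop) :
  sa (fun w : V (k + 1) => Q (lsubmx w) (rsubmx w 0 0)) ->
  sa_fun (fun w => sup [set s | Q w s]).
Proof.
move=> sQ.
have sQ' j (F : V j -> V k) (G : V j -> R) : sa_map F -> sa_fun G ->
    sa (fun w => Q (F w) (G w)).
  move=> sF sG; have /sa_pre/(_ sQ) := sa_map_row sF (sa_map_const_mx (n := 1) sG).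
  by apply: semialgebraic_ext => w; rewrite row_mxKl row_mxKr mxE.
pose H w := (exists s, Q w s) /\ (exists u, forall s, Q w s -> s <= u).
have HP w : H w <-> has_sup [set s | Q w s].
  split=> [[[s Qs] [u Qu]]|[[s Qs] [u Qu]]]; split; try by exists s.
    by exists u => y; exact: Qu.
  by exists u => y; exact: Qu.
apply: (@sa_fun_def _ _ _ (fun w t => (H w /\ (forall s, Q w s -> s <= t) /\
   forall s, s < t -> exists y, Q w y /\ s < y) \/ (~ H w /\ t = 0))).
  move=> w t; split.
    case=> [[/HP hs [tu tl]]|[/HP hs ->]]; last exact: sup_out.
    apply/eqP; rewrite eq_le; apply/andP; split.
      by apply: ge_sup; [exact: hs.1|exact: tu].
    rewrite leNgt; apply/negP => /tl[y [Qy]]; apply/negP; rewrite -leNgt.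
    exact: (ub_le_sup hs.2).
  move=> <-; have [/[dup] Hw /HP hs|nH] := pselect (H w); [left|right].
    split=> //; split=> [s Qs|s]; first exact: (ub_le_sup hs.2).
    by move=> /(sup_gt hs.1)[y Qy sy]; exists y.
  by split=> //; rewrite sup_out// => /HP.
rewrite /H; repeat (sa_step || (apply: sQ')).
Qed.

Lemma normr_sup_le (E : set R) (K : R) : 0 <= K -> (forall s, E s -> `|s| <= K) ->
  `|sup E| <= K.
Proof.
move=> K0 EK; have [hs|/sup_out->] := pselect (has_sup E); last by rewrite normr0.
have [[s Es] _] := hs; rewrite ler_norml; apply/andP; split.
  apply: le_trans (ub_le_sup hs.2 Es).
  by have := EK s Es; rewrite ler_norml => /andP[].
apply: ge_sup hs.1 _ => y /EK; rewrite ler_norml => /andP[_ ]; exact.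
Qed.

(** [sphere_sup X p i 1 e] and [- sphere_sup X p i (-1) e] are the extreme
    values of the coordinate i on the points of X at distance e from p. *)
Definition sphere_sup n (X : set (V n)) (p : V n) (i : 'I_n) (a : R) (e : R) : R :=
  sup [set s | exists x, X x /\ `|p - x| = e /\ a * x 0 i = s].

Lemma sa_sphere_sup n (X : set (V n)) p i a : sa X -> sa_fun1 (sphere_sup X p i a).
Proof.
move=> sX; pose Q (w : V 1) s := exists x, X x /\ `|p - x| = w 0 0 /\ a * x 0 i = s.
by apply: (@sa_fun_sup _ Q); rewrite /Q; sa.
Qed.

Lemma sphere_sup_bounded n (X : set (V n)) p i a (K e : R) : 0 <= K ->
  `|a| = 1 -> (forall x, X x -> `|x| <= K) -> `|sphere_sup X p i a e| <= K.
Proof.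
move=> K0 a1 XK; apply: normr_sup_le => // s [x [Xx [_ <-]]].
by rewrite normrM a1 mul1r (le_trans (ler_coord_norm x i))// XK.
Qed.

Section Key.
Variables (n : nat) (N : set (V n)) (p : V n) (K : R).
Hypothesis sN : sa N.
Hypothesis NK : forall x, N x -> `|x| <= K.
Hypothesis Np : N p.

Let A x := N x /\ x <> p.

Hypothesis p_limit : forall e : R, 0 < e -> exists2 x, A x & `|p - x| < e.
Hypothesis limits : forall f : V n -> R, sa_fun f -> cont_on A f ->
  (exists k : R, forall x, A x -> `|f x| <= k) ->
  exists l : R, forall e : R, 0 < e -> exists2 d : R, 0 < d &
    forall x, A x -> `|p - x| < d -> `|f x - l| < e.

Let K0 : 0 <= K. Proof. by rewrite (le_trans _ (NK Np)). Qed.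

Let S x (e : R) := N x /\ `|p - x| = e.

Let hi i := sphere_sup N p i 1.
Let lo i := sphere_sup N p i (-1).

Let hasS a e i : `|a| = 1 -> (exists x, S x e) ->
  has_sup [set s | exists x, N x /\ `|p - x| = e /\ a * x 0 i = s].
Proof.
move=> a1 [x [Nx px]]; split; first by exists (a * x 0 i), x.
exists K => s [y [Ny [_ <-]]]; apply: le_trans (ler_norm _) _.
by rewrite normrM a1 mul1r (le_trans (ler_coord_norm y i))// NK.
Qed.

Let leS a e i x : `|a| = 1 -> S x e -> a * x 0 i <= sphere_sup N p i a e.
Proof.
move=> a1 Sx; apply: (ub_le_sup (proj2 (hasS i a1 (ex_intro _ x Sx)))).
by case: Sx => Nx px; exists x.
Qed.

Let adh a e i (k : R) : `|a| = 1 -> (exists x, S x e) -> 0 < k ->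
  exists2 x, S x e & sphere_sup N p i a e - k < a * x 0 i.
Proof.
move=> a1 Sx k0; have [s [x [Nx [px <-]]] xk] := sup_adherent k0 (hasS i a1 Sx).
by exists x.
Qed.

(** If the coordinate i were not eventually constant on small spheres, rescaling
    it to vary between 0 and 1 on each sphere would give a bounded continuous
    function without a limit at p. *)
Lemma sphere_coord_constant i : \forall e \near 0^'+, forall x y,
  S x e -> S y e -> x 0 i = y 0 i.
Proof.
have [//|h] : (\forall e \near 0^'+, forall x y, S x e -> S y e -> x 0 i = y 0 i) \/
   (\forall e \near 0^'+, ~ forall x y, S x e -> S y e -> x 0 i = y 0 i).
  by apply: sa_right_dichotomy; rewrite /S; sa.
have n1 : `|1 : R| = 1 by rewrite normr1.
have nN1 : `|-1 : R| = 1 by rewrite normrN normr1.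
have shi : sa_fun1 (hi i) by exact: sa_sphere_sup.
have slo : sa_fun1 (lo i) by exact: sa_sphere_sup.
have hic : \forall e \near 0^'+, {for e, continuous (hi i)}.
  by apply: (sa_fun1_right_continuous (K := K)) => // t; exact: sphere_sup_bounded.
have loc : \forall e \near 0^'+, {for e, continuous (lo i)}.
  by apply: (sa_fun1_right_continuous (K := K)) => // t; exact: sphere_sup_bounded.
have /nearRP[d d0 dP] : \forall e \near 0^'+,
    [/\ ~ forall x y, S x e -> S y e -> x 0 i = y 0 i,
      {for e, continuous (hi i)} & {for e, continuous (lo i)}].
  by apply: filterS3 h hic loc.
have {h hic loc} dP e : 0 < e < d -> [/\ exists x, S x e, 0 < hi i e + lo i e,
    {for e, continuous (hi i)} & {for e, continuous (lo i)}].
  move=> ed; have [|nS hc lc] := dP e; first by rewrite add0r.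
  have [x [y [Sx Sy xy]]] : exists x y, [/\ S x e, S y e & x 0 i < y 0 i].
    apply: contrapT => nxy; apply: nS => x y Sx Sy.
    have [xy|xy|//] := ltgtP (x 0 i) (y 0 i); case: nxy; first by exists x, y; split.
    by exists y, x; split.
  split=> //; first by exists x.
  have := leS i nN1 Sx; have := leS i n1 Sy; rewrite -/(hi i e) -/(lo i e); lra.
pose r (x : V n) : R := `|p - x|.
pose q (x : V n) : R := (x 0 i + lo i (r x)) / (hi i (r x) + lo i (r x)).
have q01 x : N x -> 0 < r x < d -> 0 <= q x <= 1.
  move=> Nx rx; have [_ w0 _ _] := dP _ rx.
  have Sx : S x (r x) by [].
  have := leS i nN1 Sx; have := leS i n1 Sx; rewrite -/(hi i _) -/(lo i _) => h1 h2.
  apply/andP; split; first by rewrite divr_ge0; lra.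
  by rewrite ler_pdivrMr//; lra.
(* The factor d - r x vanishes on the sphere of radius d, so that the extension
   by 0 outside this sphere is continuous. *)
pose f (x : V n) : R := if `[< r x < d >] then (d - r x) * q x else 0.
have sf : sa_fun f by apply: sa_fun_if; rewrite /q /r; sa.
have rA x : A x -> 0 < r x.
  by move=> [_ xp]; rewrite normr_gt0 subr_eq0; apply/eqP => px; exact: xp.
have fb x : A x -> 0 <= f x <= Num.max 0 (d - r x).
  move=> Ax; rewrite /f; case: asboolP => rx; last first.
    by rewrite lexx le_max lexx.
  have /andP[q0 q1] : 0 <= q x <= 1 by apply: q01 Ax.1 _; rewrite rA.
  rewrite mulr_ge0 ?subr_ge0 ?(ltW rx)//= le_max ler_piMr ?orbT//.
  by rewrite subr_ge0 ltW.
pose B (x : V n) := N x /\ 0 < r x < d.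
have cr : cont_on B r.
  by apply: cont_on_norm; apply: cont_onB; [exact: cont_on_cst|exact: cont_on_id].
have cB : cont_on B (fun x => (d - r x) * q x).
  have rB x : B x -> [set e | 0 < e < d] (r x) by case.
  have ch : cont_on B (hi i \o r).
    apply: cont_on_comp rB cr _ => e ed; have [_ _ hc _] := dP e ed.
    exact: cvg_within_filter.
  have cl : cont_on B (lo i \o r).
    apply: cont_on_comp rB cr _ => e ed; have [_ _ _ lc] := dP e ed.
    exact: cvg_within_filter.
  have cx : cont_on B (fun x => x 0 i) by apply: cont_on_coord; exact: cont_on_id.
  apply: (@cont_onM _ _ _ (fun x => d - r x) q).
    by apply: cont_onB => //; exact: cont_on_cst.
  rewrite /q; apply: (@cont_onM _ _ _ (fun x : V n => x 0 i + lo i (r x))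
    (fun x => (hi i (r x) + lo i (r x))^-1)); first exact: cont_onD.
  apply: cont_on_inv; last exact: cont_onD.
  by move=> x [_ /dP[_ w0 _ _]]; rewrite gt_eqF.
have cf : cont_on A f.
  apply/cont_onP => x Ax e e0; have [rd|dr] := ltP (r x) d; last first.
    exists e => // y Ay xy; rewrite {1}/f asboolF; last by rewrite ltNge dr.
    have /andP[fy0 fy] := fb y Ay; rewrite sub0r normrN ger0_norm//.
    apply: (le_lt_trans fy); rewrite gt_max e0/=.
    have : r x - r y <= `|x - y|.
      by rewrite lerBlDr /r (distrC x y) [leRHS]addrC ler_distD.
    lra.
  have [t t0 ct] := (cont_onP _ _).1 cB x (conj Ax.1 (introT andP (conj (rA x Ax) rd))) e e0.
  exists (Num.min t (d - r x)); first by rewrite lt_min t0 subr_gt0.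
  move=> y Ay; rewrite lt_min => /andP[xyt xyd].
  have ryd : r y < d.
    rewrite -(subrK (r x) d); apply: le_lt_trans (_ : `|x - y| + r x < _); last by rewrite ltrD2r.
    by rewrite /r [leRHS]addrC ler_distD.
  rewrite /f !asboolT//; apply: ct => //; split; first exact: Ay.1.
  by rewrite rA.
have [|l lP] := limits sf cf.
  exists d => x Ax; have /andP[f0 fx] := fb x Ax; rewrite ger0_norm// (le_trans fx)//.
  by rewrite ge_max (ltW d0) gerBl normr_ge0.
have [|t t0 lt] := lP (d / 8); first by rewrite divr_gt0.
(* On the sphere of radius e < d / 4, f takes a value above 9 d / 16 and one
   below d / 4: these are not both within d / 8 of l. *)
pose e := Num.min t (d / 4) / 2.
have m0 : 0 < Num.min t (d / 4) by rewrite lt_min t0 divr_gt0.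
have [mt md] : Num.min t (d / 4) <= t /\ Num.min t (d / 4) <= d / 4.
  by rewrite !ge_min !lexx orbT.
have [e0 et ed] : [/\ 0 < e, e < t & e < d / 4] by rewrite /e; split; lra.
have edd : 0 < e < d by rewrite e0; lra.
have [Se w0 _ _] := dP e edd.
have w4 : 0 < (hi i e + lo i e) / 4 by lra.
have [x Sx xhi] := adh i n1 Se w4; have [y Sy ylo] := adh i nN1 Se w4.
have SA z : S z e -> A z.
  move=> [Nz pz]; split=> // zp; move: pz e0; rewrite zp subrr normr0 => <-.
  by rewrite ltxx.
have fE z : S z e -> f z = (d - e) * ((z 0 i + lo i e) / (hi i e + lo i e)).
  by move=> [_ pz]; rewrite /f /q /r pz asboolT//; case/andP: edd.
have Sl z : S z e -> `|f z - l| < d / 8.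
  by move=> /[dup] Sz [_ pz]; apply: lt; [exact: SA|rewrite pz].
have qx : 3 / 4 < (x 0 i + lo i e) / (hi i e + lo i e).
  by rewrite ltr_pdivlMr//; move: xhi; rewrite -/(hi i e); lra.
have qy : (y 0 i + lo i e) / (hi i e + lo i e) < 1 / 4.
  by rewrite ltr_pdivrMr//; move: ylo; rewrite -/(lo i e); lra.
have qy0 : 0 <= (y 0 i + lo i e) / (hi i e + lo i e).
  by rewrite divr_ge0 ?(ltW w0)//; have := leS i nN1 Sy; rewrite -/(lo i e); lra.
have := Sl x Sx; have := Sl y Sy; rewrite (fE x Sx) (fE y Sy) !ltr_norml.
move: qx qy qy0; set a := (x 0 i + _) / _; set b := (y 0 i + _) / _ => qx qy qy0.
have de : 0 < d - e by lra.
have h1 : 0 < (d - e) * (a - 3 / 4) by rewrite mulr_gt0// subr_gt0.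
have h2 : 0 < (d - e) * (1 / 4 - b) by rewrite mulr_gt0// subr_gt0.
by move=> /andP[? ?] /andP[? ?]; lra.
Qed.

(** Small spheres around p meet N because p is a limit point, and in one point
    because all coordinates are constant on them. *)
Lemma limits_sphere_end : sphere_end N p.
Proof.
split=> //.
have ex : \forall e \near 0^'+, exists x, S x e.
  have [//|/nearRP[d d0 dP]] : (\forall e \near 0^'+, exists x, S x e) \/
     (\forall e \near 0^'+, ~ exists x, S x e).
    by apply: sa_right_dichotomy; rewrite /S; sa.
  have [x [Nx xp] pxd] := p_limit d0; case: (dP `|p - x|); last by exists x.
  rewrite add0r pxd andbT normr_gt0 subr_eq0; apply/eqP => px; exact: xp.
have : \forall e \near 0^'+, forall i x y, S x e -> S y e -> x 0 i = y 0 i.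
  by apply: filter_forall => i; exact: sphere_coord_constant.
move=> xu; have /nearRP[d d0 dP] : \forall e \near 0^'+, (exists x, S x e) /\
    forall i x y, S x e -> S y e -> x 0 i = y 0 i by apply: filterS2 ex xu.
exists d; split=> // e ed.
have [|[x Sx] {}xu] := dP e; first by rewrite add0r.
by exists x; split=> // y Sy; apply/rowP => i; exact: xu.
Qed.

End Key.
End Oscillation.

(** * Ends of dense subsets and of homeomorphic images *)

Section DenseEnds.
Variable R : realType.
Notation V n := 'rV[R]_n.
Notation sa A := (semialgebraic A).

Section Dense.
Variables (n : nat) (N B : set (V n)).
Hypotheses (sB : sa B) (BN : B `<=` N).
Hypothesis dB : forall x (e : R), N x -> 0 < e -> exists2 y, B y & `|x - y| < e.

(** If small spheres around p missed B, then B would not be dense in N near the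
    points of N on these spheres. *)
Lemma sphere_end_dense_sub p : B p -> sphere_end N p -> sphere_end B p.
Proof.
move=> Bp [_ [d [d0 dN]]]; split=> //.
have [/nearRP[r r0 rB]|/nearRP[r r0 rB]] :
    (\forall e \near 0^'+, exists x, B x /\ `|p - x| = e) \/
    (\forall e \near 0^'+, ~ exists x, B x /\ `|p - x| = e).
  by apply: sa_right_dichotomy; sa.
  exists (Num.min d r); split; first by rewrite lt_min d0.
  move=> e /andP[e0]; rewrite lt_min => /andP[ed er].
  have [|x [Bx px]] := rB e; first by rewrite add0r e0.
  have [|x' [_ xu]] := dN e; first by rewrite e0.
  exists x; split=> // y [By py].
  by rewrite (xu y (conj (BN By) py)) [RHS](xu x (conj (BN Bx) px)).
pose e := Num.min d r / 2.
have m0 : 0 < Num.min d r by rewrite lt_min d0.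
have [md mr] : Num.min d r <= d /\ Num.min d r <= r by rewrite !ge_min !lexx orbT.
have [e0 ed er] : [/\ 0 < e, e < d & e <= r / 2] by rewrite /e; split; lra.
have [|x [[Nx px] _]] := dN e; first by rewrite e0.
have [|y By xy] := dB Nx (_ : 0 < e / 2); first by rewrite divr_gt0.
case: (rB `|p - y|); last by exists y.
have h1 := ler_distD y p x; have h2 := ler_distD x p y.
by rewrite (distrC y x) px in h1; rewrite px in h2; apply/andP; split; lra.
Qed.

(** A point of N at small distance e from p is a limit of points of B, which lie
    on the arc at distances tending to e; so it is the point of the arc at
    distance e. *)
Lemma sphere_end_dense_super p : sphere_end B p -> sphere_end N p.
Proof.
move=> /[dup] -[Bp _] /(radial_arc sB)[r [c [r0 ac cr cX]]]; split; first exact: BN.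
exists r; split=> // e /andP[e0 er].
have Ie : I01 (e / r).
  by rewrite /I01 (divr_ge0 (ltW e0) (ltW r0))/= ltr_pdivrMr// mul1r.
exists (c (e / r)); split.
  by split; [apply: BN; exact: arc_in ac _ Ie|rewrite cr// mulrC divfK// gt_eqF].
move=> x [Nx px]; apply/eqP; rewrite -subr_eq0 -normr_eq0; apply/negPn/negP => k0.
have {}k0 : 0 < `|x - c (e / r)| by rewrite lt_neqAle eq_sym k0 normr_ge0.
set k := `|_| in k0.
have k2 : 0 < k / 2 by rewrite divr_gt0.
have [d d0 dc] := (cont_onP _ _).1 (arc_cont ac) _ Ie _ k2.
pose m := Num.min (k / 2) (Num.min (r * d) (r - e)).
have m0 : 0 < m by rewrite !lt_min k2 mulr_gt0//= subr_gt0.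
have [y By xy] := dB Nx m0; move: xy; rewrite !lt_min => /and3P[xyk xyd xyr].
have h1 := ler_distD y p x; have h2 := ler_distD x p y.
rewrite (distrC y x) px in h1; rewrite px in h2.
have [|s Is cs] := cX y By; first lra.
have ps : `|p - y| = r * s by rewrite -cs cr.
have /(dc s Is) : `|e / r - s| < d.
  rewrite -(ltr_pM2l r0) -{1}(gtr0_norm r0) -normrM mulrBr -ps.
  rewrite (mulrC r) divfK ?gt_eqF// ltr_norml; apply/andP; split; lra.
rewrite cs => h3; have := ler_distD y x (c (e / r)).
by rewrite -/k (distrC y (c _)); lra.
Qed.

Lemma sphere_end_dense : (forall x, N x -> ~ B x -> sphere_end N x) ->
  forall x, (N x /\ ~ sphere_end N x) <-> (B x /\ ~ sphere_end B x).
Proof.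
move=> NB x; split=> -[xN xE].
  have Bx : B x by apply: contrapT => /(NB x xN).
  by split=> // /sphere_end_dense_super.
by split=> [|/(sphere_end_dense_sub xN)//]; exact: BN.
Qed.

End Dense.

(** Homeomorphisms as maps of the ambient spaces; the inverse is part of the
    data, which makes the notion symmetric. *)
Record sa_homeo m n (A : set (V m)) (B : set (V n)) (f : V m -> V n)
    (g : V n -> V m) : Prop := SaHomeo {
  homeo_sa : sa_map f; homeo_saV : sa_map g;
  homeo_in : forall x, A x -> B (f x); homeo_inV : forall y, B y -> A (g y);
  homeoK : forall x, A x -> g (f x) = x; homeoKV : forall y, B y -> f (g y) = y;
  homeo_cont : cont_on A f; homeo_contV : cont_on B g }.

Lemma sa_homeo_sym m n (A : set (V m)) (B : set (V n)) f g :
  sa_homeo A B f g -> sa_homeo B A g f.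
Proof. by case=> *; split. Qed.

Lemma end_arc_homeo m n (A : set (V m)) (B : set (V n)) f g p c :
  sa_homeo A B f g -> end_arc A p c -> end_arc B (f p) (f \o c).
Proof.
move=> H ac; have Ap : A p by rewrite -(arc0 ac); apply: (arc_in ac); exact: I01_0.
split=> /=.
- by have sf := homeo_sa H; have sc := arc_sa ac => i; rewrite /sa_fun1 /=; sa.
- by rewrite (arc0 ac).
- by move=> t /(arc_in ac)/(homeo_in H).
- apply: cont_on_comp (arc_cont ac) (homeo_cont H); exact: (arc_in ac).
- move=> s t Is It fst; apply: (arc_inj ac) => //.
  by rewrite -(homeoK H (arc_in ac Is)) fst (homeoK H (arc_in ac It)).
- move=> d /(arc_nbhs ac)[r r0 rA].
  have [e e0 eg] := (cont_onP _ _).1 (homeo_contV H) _ (homeo_in H Ap) _ r0.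
  exists e => // y By pye; have [|t [It td] ct] := rA (g y) (homeo_inV H By).
    by rewrite -{1}(homeoK H Ap); apply: eg.
  by exists t => //; rewrite ct (homeoKV H).
Qed.

Lemma sphere_end_homeo m n (A : set (V m)) (B : set (V n)) f g p : sa A ->
  sa_homeo A B f g -> sphere_end A p -> sphere_end B (f p).
Proof.
move=> sA H /(radial_arc sA)[r [c [_ ac _ _]]].
exact: arc_sphere_end (end_arc_homeo H ac).
Qed.

(** Ends are preserved by homeomorphisms, which therefore restrict to the
    complements of the sets of ends. *)
Lemma sa_homeo_end_compl m n (A : set (V m)) (B : set (V n)) f g : sa A -> sa B ->
  sa_homeo A B f g -> sa_homeo (A `\` sphere_end A) (B `\` sphere_end B) f g.
Proof.
move=> sA sB H; split.
- exact: homeo_sa H.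
- exact: homeo_saV H.
- move=> x [Ax nx]; split; first exact: homeo_in H x Ax.
  move=> /(sphere_end_homeo sB (sa_homeo_sym H)).
  by rewrite (homeoK H Ax).
- move=> y [By ny]; split; first exact: homeo_inV H y By.
  move=> /(sphere_end_homeo sA H).
  by rewrite (homeoKV H By).
- by move=> x [Ax _]; exact: homeoK H x Ax.
- by move=> y [By _]; exact: homeoKV H y By.
- by apply: cont_onW (homeo_cont H) => x [].
- by apply: cont_onW (homeo_contV H) => x [].
Qed.

End DenseEnds.

(** * Subsets as types *)

Section Subtypes.
Variable R : realType.
Notation V n := 'rV[R]_n.
Notation sa A := (semialgebraic A).

Definition subtype_elt (T : Type) (A : set T) x (Ax : A x) : A := exist _ x (mem_set Ax).

Lemma set_val_in (T : choiceType) (A : set T) x (Ax : A x) : set_val (subtype_elt Ax) = x.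
Proof. by rewrite set_valE. Qed.

Lemma set_val_prop (T : choiceType) (A : set T) (x : A) : A (set_val x).
Proof. by rewrite set_valE; exact: set_valP. Qed.

Lemma set_val_inj (T : choiceType) (A : set T) (x y : A) : set_val x = set_val y -> x = y.
Proof. by rewrite !set_valE => /val_inj. Qed.

Definition zero_ext (m n : nat) (A : set (V m)) (h : A -> V n) (x : V m) : V n :=
  if pselect (A x) is left Ax then h (subtype_elt Ax) else 0.

Lemma zero_ext_val m n (A : set (V m)) (h : A -> V n) (x : A) : zero_ext h (set_val x) = h x.
Proof.
rewrite /zero_ext; case: pselect => [Ax|[]]; last exact: set_val_prop.
by congr h; apply: set_val_inj; rewrite set_val_in.
Qed.

Lemma zero_ext_out m n (A : set (V m)) (h : A -> V n) x : ~ A x -> zero_ext h x = 0.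
Proof. by rewrite /zero_ext; case: pselect. Qed.

Lemma fun_graphE m n (A : set (V m)) (h : A -> V n) x y :
  fun_graph h (row_mx x y) <-> A x /\ zero_ext h x = y.
Proof.
split=> [[a _ /eq_row_mx[<- <-]]|[Ax <-]].
  by split; [exact: set_val_prop|exact: zero_ext_val].
by exists (subtype_elt Ax) => //; rewrite -(zero_ext_val h) !set_val_in.
Qed.

Lemma fun_graph_dom m n (A : set (V m)) (h : A -> V n) : sa (fun_graph h) -> sa A.
Proof.
move=> sh; have : sa (fun x => exists y, fun_graph h (row_mx x y)) by sa.
apply: semialgebraic_ext => x; split=> [[y /fun_graphE[]]//|Ax].
by exists (zero_ext h x); apply/fun_graphE.
Qed.

Lemma sa_map_zero_ext m n (A : set (V m)) (h : A -> V n) :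
  sa (fun_graph h) -> sa_map (zero_ext h).
Proof.
move=> sh i; have sA := fun_graph_dom sh.
apply: (@sa_fun_def _ _ _ (fun x t =>
  (exists y, fun_graph h (row_mx x y) /\ y 0 i = t) \/ (~ A x /\ 0 = t))); last by sa.
move=> x t; split=> [[[y [/fun_graphE[_ ->]//]]|[/zero_ext_out-> <-]]|<-].
  by rewrite mxE.
have [Ax|nA] := pselect (A x); [left|right].
  by exists (zero_ext h x); split=> //; apply/fun_graphE.
by split=> //; rewrite zero_ext_out// mxE.
Qed.

Lemma sa_fun_graph m n (A : set (V m)) (f : V m -> V n) (h : A -> V n) : sa A ->
  sa_map f -> (forall x, h x = f (set_val x)) -> sa (fun_graph h).
Proof.
move=> sA sf hf.
have : sa (fun z : V (m + n) => A (lsubmx z) /\ f (lsubmx z) = rsubmx z) by sa.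
apply: semialgebraic_ext => z; rewrite -[in X in _ <-> X](hsubmxK z) fun_graphE.
by split=> -[Az <-]; split=> //; rewrite -(set_val_in Az) zero_ext_val hf.
Qed.

Lemma semialg_funP m (M : set (V m)) (f : M -> R) : sa M ->
  semialg_fun f <-> exists F : V m -> R,
    [/\ sa_fun F, cont_on M F & forall x, f x = F (set_val x)].
Proof.
move=> sM; split=> [[cf sf]|[F [sF cF fF]]].
  exists (fun x => zero_ext (fun x => const_mx (f x) : V 1) x 0 0).
  have fF (x : M) : f x = zero_ext (fun x => const_mx (f x) : V 1) (set_val x) 0 0.
    by rewrite zero_ext_val mxE.
  by split; [exact: sa_map_zero_ext sf 0|exact/(cont_on_sig fF)|].
split; first exact/(cont_on_sig fF).
apply: (sa_fun_graph (f := fun x => const_mx (F x))) => //.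
  exact: sa_map_const_mx.
by move=> x; rewrite fF.
Qed.

Lemma semialg_homeo_ambient m n (A : set (V m)) (B : set (V n)) (h : A -> B) :
  sa B -> semialg_homeo h ->
  exists f g, sa_homeo A B f g /\ forall x, f (set_val x) = set_val (h x).
Proof.
move=> sB [[ch sh] [k [hk kh ck]]].
have sA := fun_graph_dom sh; have sf := sa_map_zero_ext sh.
pose f := zero_ext (fun x : A => set_val (h x)); pose g := zero_ext (fun y : B => set_val (k y)).
have fE x : f (set_val x) = set_val (h x) by rewrite /f zero_ext_val.
have gE y : g (set_val y) = set_val (k y) by rewrite /g zero_ext_val.
have fi x : A x -> B (f x).
  by move=> Ax; rewrite -(set_val_in Ax) fE; exact: set_val_prop.
have gi y : B y -> A (g y).
  by move=> By; rewrite -(set_val_in By) gE; exact: set_val_prop.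
have fg x : A x -> g (f x) = x.
  by move=> Ax; rewrite -(set_val_in Ax) fE gE hk.
have gf y : B y -> f (g y) = y.
  by move=> By; rewrite -(set_val_in By) gE fE kh.
exists f, g; split=> //; split=> //.
- move=> i; apply: (@sa_fun_def _ _ _ (fun y t =>
    (B y /\ exists x, A x /\ f x = y /\ x 0 i = t) \/ (~ B y /\ 0 = t))); last by sa.
  move=> y t; split.
    case=> [[By [x [Ax [<- <-]]]]|[nB <-]]; first by rewrite fg.
    by rewrite /g zero_ext_out// mxE.
  move=> <-; have [By|nB] := pselect (B y); [left|right].
    by split=> //; exists (g y); rewrite gf//; split=> //; exact: gi.
  by split=> //; rewrite /g zero_ext_out// mxE.
- exact/(cont_on_sig (f := fun x => set_val (h x))).
- by apply/(cont_on_sig (f := fun x => set_val (k x))) => //; exact/continuous_set_val.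
Qed.

Lemma sa_homeo_semialg m n (A : set (V m)) (B : set (V n)) f g :
  sa A -> sa_homeo A B f g ->
  exists h : A -> B, semialg_homeo h /\ forall x, f (set_val x) = set_val (h x).
Proof.
move=> sA H.
pose h (x : A) : B := subtype_elt (homeo_in H (set_val_prop x)).
pose k (y : B) : A := subtype_elt (homeo_inV H (set_val_prop y)).
have hE x : set_val (h x) = f (set_val x) by rewrite set_val_in.
have kE y : set_val (k y) = g (set_val y) by rewrite set_val_in.
exists h; split=> //; split.
  split; first by apply/(cont_on_sig hE); exact: homeo_cont H.
  exact: sa_fun_graph sA (homeo_sa H) hE.
exists k; split.
- by move=> x; apply: set_val_inj; rewrite kE hE (homeoK H)//; exact: set_val_prop.
- by move=> x; apply: set_val_inj; rewrite hE kE (homeoKV H)//; exact: set_val_prop.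
- by apply/continuous_set_val/(cont_on_sig kE); exact: homeo_contV H.
Qed.

Lemma sa_unit_Ico : sa (@unit_Ico R).
Proof. by rewrite /unit_Ico /mkset; sa. Qed.

(** An arc parametrized by the distance to its end is inverse to a multiple of
    that distance; conversely the inverse of a homeomorphism onto the interval
    is an arc. *)
Lemma eta_setE m (M : set (V m)) : sa M -> eta_set M = sphere_end M.
Proof.
move=> sM; apply/seteqP; split=> p; last first.
  move=> /(radial_arc sM)[r [c [r0 ac cr cX]]].
  have sc := arc_sa ac.
  have Mp : M p by rewrite -(arc0 ac); apply: (arc_in ac); exact: I01_0.
  pose U x := M x /\ `|p - x| < r.
  have sU : sa U by rewrite /U; sa.
  exists U; split=> //.
    exists (ball p r); split; first exact: ball_open.
    by rewrite -ball_normE.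
  pose f x : V 1 := const_mx (`|p - x| / r); pose g (w : V 1) := c (w 0 0).
  have fc t : I01 t -> f (c t) = const_mx t.
    by move=> It; rewrite /f cr// mulrC mulKf// gt_eqF.
  have H : sa_homeo U (@unit_Ico R) f g.
    split.
    - by rewrite /f; sa.
    - by rewrite /g; sa.
    - move=> x [Mx pr]; rewrite /unit_Ico/= mxE ltr_pdivrMr// mul1r pr andbT.
      by rewrite divr_ge0// ltW.
    - move=> w /= Iw; split; first exact: (arc_in ac).
      by rewrite cr// gtr_pMr//; case/andP: Iw.
    - move=> x [Mx /(cX x Mx)[t It <-]]; by rewrite fc// /g mxE.
    - move=> w Iw; rewrite /g fc//; apply/rowP => i.
      by rewrite mxE ord1.
    - apply: cont_on_rV => i.
      apply: (cont_on_eq (f := fun x => `|p - x| / r)) => [x _|]; first by rewrite mxE.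
      apply: (@cont_onM _ _ _ (fun x => `|p - x|) (fun=> r^-1)); last exact: cont_on_cst.
      by apply: cont_on_norm; apply: cont_onB; [exact: cont_on_cst|exact: cont_on_id].
    - apply: (cont_on_comp (f := fun w : V 1 => w 0 0)) (arc_cont ac) => //.
      by apply: cont_on_coord; exact: cont_on_id.
  have [h [hh hE]] := sa_homeo_semialg sU H.
  have Up : U p by split=> //; rewrite subrr normr0.
  exists h; split=> //; exists (subtype_elt Up); rewrite set_val_in; split=> //.
  rewrite -hE set_val_in /f subrr normr0 mul0r.
  by apply/rowP => i; rewrite !mxE.
case=> U [sU [O [oO UE]] [h [hh [x0 [x0p hx0]]]]].
have [f [g [H fE]]] := semialg_homeo_ambient sa_unit_Ico hh.
have Ux0 : U p by rewrite -x0p; exact: set_val_prop.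
have f0 : f p = 0 by rewrite -x0p fE.
have sg := homeo_saV H.
have Ico (t : R) : I01 t -> unit_Ico (const_mx t : V 1).
  by rewrite /I01 /unit_Ico/= mxE.
apply: (@arc_sphere_end _ _ _ _ (fun t => g (const_mx t))); split.
- by move=> i; rewrite /sa_fun1; sa.
- rewrite (_ : const_mx 0 = f p); first by rewrite (homeoK H).
  by rewrite f0; apply/rowP => i; rewrite !mxE.
- by move=> t /Ico/(homeo_inV H); rewrite UE => -[].
- apply: (cont_on_comp (f := fun t => const_mx t : V 1)) (homeo_contV H); first exact: Ico.
  apply: cont_on_rV => i.
  by apply: (cont_on_eq (f := id)) => [t _|]; [rewrite mxE|exact: cont_on_id].
- move=> s t Is It gst; have : const_mx s = const_mx t :> V 1.
    by rewrite -(homeoKV H (Ico _ Is)) gst (homeoKV H (Ico _ It)).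
  by move=> /rowP/(_ 0); rewrite !mxE.
- move=> d d0.
  have [e e0 fe] := (cont_onP _ _).1 (homeo_cont H) _ Ux0 d d0.
  have Op : O p by move: Ux0; rewrite UE => -[].
  have /nbhs_ballP[r /= r0 rO] := open_nbhs_nbhs (conj oO Op).
  exists (Num.min e r); first by rewrite lt_min e0.
  move=> x Mx; rewrite lt_min => /andP[xe xr].
  have Ux : U x by rewrite UE; split=> //; apply: rO; rewrite -ball_normE.
  have := homeo_in H Ux; rewrite /unit_Ico/= => If.
  have fx : const_mx (f x 0 0) = f x by apply/rowP => i; rewrite mxE ord1.
  exists (f x 0 0); last by rewrite fx (homeoK H).
  split=> //; have := fe x Ux xe; rewrite f0 sub0r normrN.
  by apply: le_lt_trans; apply: le_trans (ler_coord_norm _ 0); exact: ler_norm.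
Qed.

End Subtypes.

(** * Extension of bounded functions to the ends *)

Section Extension.
Variable R : realType.
Notation V n := 'rV[R]_n.
Notation sa A := (semialgebraic A).

Section Ext.
Variables (m : nat) (M : set (V m)).
Hypothesis sM : sa M.

Let M0 := M `\` sphere_end M.

(** An end is the limit of the interior of its arc, which contains no end. *)
Lemma end_compl_dense x (e : R) : M x -> 0 < e -> exists2 y, M0 y & `|x - y| < e.
Proof.
move=> Mx e0; have [Ex|nEx] := pselect (sphere_end M x); last first.
  by exists x => //; rewrite subrr normr0.
have [r [c [r0 ac cr _]]] := radial_arc sM Ex.
pose t := Num.min (1 / 2) (e / r / 2).
have t0 : 0 < t by rewrite lt_min !divr_gt0.
have t1 : t < 1 by rewrite gt_min; apply/orP; left; lra.
have It : I01 t by rewrite /I01 (ltW t0) t1.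
exists (c t); last first.
  rewrite cr// mulrC -ltr_pdivlMr// gt_min; apply/orP; right.
  by rewrite ltr_pdivrMr// ltr_pMr ?divr_gt0// ltr1n.
split; first exact: (arc_in ac).
by apply: (arc_interior ac); rewrite t0.
Qed.

Lemma bounded_end_limit (f : V m -> R) (k : R) p : sa_fun f ->
  (forall x, M0 x -> `|f x| <= k) -> sphere_end M p ->
  exists l : R, forall e : R, 0 < e -> exists2 d : R, 0 < d &
    forall x, M0 x -> `|p - x| < d -> `|f x - l| < e.
Proof.
move=> sf fk Ep; have [r [c [r0 ac cr _]]] := radial_arc sM Ep.
have sc := arc_sa ac; have su : sa_fun1 (fun t => f (c t)) by sa.
have /(sa_fun1_right_limit su)/cvg_ex[l fl] : \forall t \near 0^'+, `|f (c t)| <= k.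
  apply/nearRP; exists 1; first exact: ltr01.
  move=> t; rewrite add0r => /[dup] t01 /andP[t0 t1]; apply: fk; split.
    by apply: (arc_in ac); rewrite /I01 ltW.
  exact: (arc_interior ac).
exists l => e e0; have /nearRP[d d0 fd] : \forall t \near 0^'+, `|l - f (c t)| < e.
  by move/cvgrPdist_lt: fl; exact.
have [s s0 sX] := arc_nbhs ac d0; exists s => // x [Mx nEx] xs.
have [t [/andP[t0 t1] td] cx] := sX x Mx xs; rewrite distrC -cx; apply: fd.
rewrite add0r td andbT lt_neqAle t0 andbT; apply/eqP => t00; apply: nEx.
by rewrite -cx -t00 (arc0 ac).
Qed.

(** A bounded semialgebraic function has a limit along the arc that ends at
    each end, so it extends to the ends; the extension is continuous because
    it is given by limits everywhere. *)
Lemma bounded_extension (f : V m -> R) (k : R) : sa_fun f -> cont_on M0 f ->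
  (forall x, M0 x -> `|f x| <= k) -> exists F : V m -> R,
    [/\ sa_fun F, cont_on M F, forall x, M x -> `|F x| <= k + 1 &
        forall x, M0 x -> F x = f x].
Proof.
move=> sf cf fk; pose lim x l := forall e : R, 0 < e -> exists d : R, 0 < d /\
    forall y, M0 y -> `|x - y| < d -> `|f y - l| < e.
have limU x l l' : M x -> lim x l -> lim x l' -> l = l'.
  move=> Mx xl xl'; apply/eqP; rewrite -subr_eq0 -normr_eq0; apply/negPn/negP => n0.
  have {}n0 : 0 < `|l - l'| / 2 by rewrite divr_gt0// lt_neqAle eq_sym n0 normr_ge0.
  have [d [d0 dl]] := xl _ n0; have [d' [d'0 dl']] := xl' _ n0.
  have m0 : 0 < Num.min d d' by rewrite lt_min d0.
  have [y M0y] := end_compl_dense Mx m0; rewrite lt_min => /andP[yd yd'].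
  have := ler_distD (f y) l l'; have := dl y M0y yd; have := dl' y M0y yd'.
  by rewrite (distrC l (f y)); lra.
have /choice[F FE] x : exists l, if `[< M x >] then lim x l else l = 0.
  case: asboolP => Mx; last by exists 0.
  have [Ex|nEx] := pselect (sphere_end M x).
    have [l lE] := bounded_end_limit sf fk Ex.
    by exists l => e /lE[d d0 dl]; exists d.
  exists (f x) => e e0; have [d d0 dl] := (cont_onP _ _).1 cf x (conj Mx nEx) e e0.
  by exists d; split=> // y M0y xy; rewrite distrC; exact: dl.
have Flim x : M x -> lim x (F x) by move=> Mx; have := FE x; rewrite asboolT.
have Fout x : ~ M x -> F x = 0 by move=> Mx; have := FE x; rewrite asboolF.
exists F; split.
- have sM0 : sa M0 by apply: sa_and => //; apply: sa_not; exact: sa_sphere_end.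
  apply: (@sa_fun_def _ _ _ (fun x t => (M x /\ lim x t) \/ (~ M x /\ 0 = t))).
    move=> x t; split=> [[[Mx /(limU x (F x) t Mx (Flim x Mx))//]|[/Fout->//]]|<-].
    by have [Mx|nM] := pselect (M x); [left; split=> //; exact: Flim|right; rewrite Fout].
  by rewrite /lim; sa.
- apply/cont_onP => x Mx e e0; have e2 : 0 < e / 2 by rewrite divr_gt0.
  have [d [d0 dx]] := Flim x Mx _ e2; exists (d / 2); first by rewrite divr_gt0.
  move=> y My xy; have [d' [d'0 dy]] := Flim y My _ e2.
  have m0 : 0 < Num.min d' (d / 2) by rewrite lt_min d'0 divr_gt0.
  have [z M0z] := end_compl_dense My m0; rewrite lt_min => /andP[yz yz'].
  have h1 := dy z M0z yz.
  have h2 : `|f z - F x| < e / 2.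
    by apply: dx => //; have := ler_distD y x z; lra.
  by have := ler_distD (f z) (F x) (F y); rewrite (distrC (F x) (f z)); lra.
- move=> x Mx; have [d [d0 dx]] := Flim x Mx 1 ltr01.
  have [y M0y xy] := end_compl_dense Mx d0.
  have := ler_distD (f y) (F x) 0; rewrite !subr0 distrC.
  by have := dx y M0y xy; have := fk y M0y; lra.
- move=> x /[dup] M0x [Mx nEx]; apply: (limU x) => //; first exact: Flim.
  move=> e e0; have [d d0 dl] := (cont_onP _ _).1 cf x M0x e e0.
  by exists d; split=> // y M0y xy; rewrite distrC; exact: dl.
Qed.

End Ext.

Lemma compact_bounded_fun m (N : set (V m)) (F : V m -> R) : compact N ->
  cont_on N F -> exists k : R, forall x, N x -> `|F x| <= k.
Proof.
move=> cN cF; have [N0|nN0] := pselect (N !=set0); last first.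
  by exists 0 => x Nx; case: nN0; exists x.
have /cont_on_within cnF := cont_on_norm (cF : cont_on N (F : V m -> R^o)).
have [c _ cmax] := compact_EVT_max N0 cN cnF.
by exists `|F c| => x Nx; apply: cmax; exact: mem_set.
Qed.

End Extension.

(** * From homeomorphisms to isomorphisms *)

(** It is easier to say when two elements correspond to each other than to
    describe the image of an element. *)
Lemma rmorphism_of_relation (A B : pzRingType) (T : A -> B -> Prop) :
  (forall a, exists b, T a b) -> (forall b, exists a, T a b) ->
  (forall a b b', T a b -> T a b' -> b = b') ->
  (forall a a' b, T a b -> T a' b -> a = a') ->
  T 1 1 -> (forall a a' b b', T a b -> T a' b' -> T (a - a') (b - b')) ->
  (forall a a' b b', T a b -> T a' b' -> T (a * a') (b * b')) ->
  exists phi : {rmorphism A -> B}, bijective phi.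
Proof.
move=> /choice[phi phiT] /choice[psi psiT] Tr Tl T1 TB TM.
have phiB : {morph phi : x y / x - y} by move=> x y; apply: Tr (TB _ _ _ _ _ _).
have phiM : GRing.monoid_morphism phi.
  by split=> [|x y]; [exact: Tr (phiT 1) T1|apply: Tr (TM _ _ _ _ _ _)].
pose Phi : {rmorphism A -> B} := HB.pack phi
  (GRing.isZmodMorphism.Build A B phi phiB)
  (GRing.isMonoidMorphism.Build A B phi phiM).
exists Phi; exists psi => x; first exact: Tl (psiT _) (phiT x).
exact: Tr (phiT _) (psiT x).
Qed.

Section Rings.
Variables (R : realType) (m : nat) (M : set 'rV[R]_m) (hM : semialgebraic M).
Notation V n := 'rV[R]_n.

Definition represents (F : V m -> R) (a : M -> R) := [/\ sa_fun F, cont_on M F &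
  forall x, a x = F (set_val x)].

Lemma semialg_ring_represented (a : semialg_ring hM) : exists F, represents F a.
Proof.
by have /asboolP/(semialg_funP _ hM)[F] := semialg_ringP a; exists F.
Qed.

Lemma semialg_ring_ex (F : V m -> R) : sa_fun F -> cont_on M F ->
  exists a : semialg_ring hM, represents F a.
Proof.
move=> sF cF; have aP : (fun x : M => F (set_val x)) \in semialg_fun_pred hM.
  by apply/asboolP/(semialg_funP _ hM); exists F.
by exists (SemialgRing aP).
Qed.

Lemma bounded_ring_represented (a : bounded_semialg_ring hM) :
  exists F k, represents F a /\ forall x, M x -> `|F x| <= k.
Proof.
have [F [sF cF aF]] := semialg_ring_represented (bounded_semialg_ring_val a).
have /asboolP[k ak] := bounded_semialg_ringP a.
exists F, k; split=> // x Mx; rewrite -(set_val_in Mx) -aF; exact: ak.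
Qed.

Lemma bounded_ring_ex (F : V m -> R) (k : R) : sa_fun F -> cont_on M F ->
  (forall x, M x -> `|F x| <= k) ->
  exists a : bounded_semialg_ring hM, represents F a.
Proof.
move=> sF cF Fk; have [a [_ _ aF]] := semialg_ring_ex sF cF.
have aP : a \in @bounded_pred _ _ _ hM.
  by apply/asboolP; exists k => x; rewrite aF; apply: Fk; exact: set_val_prop.
by exists (BoundedSemialgRing aP).
Qed.

Lemma semialg_ring_eq (a b : semialg_ring hM) : (forall x, a x = b x) -> a = b.
Proof. by move=> ab; apply: val_inj; apply/funext => x; exact: ab. Qed.

Lemma bounded_ring_eq (a b : bounded_semialg_ring hM) : (forall x, a x = b x) -> a = b.
Proof. by move=> ab; apply: val_inj; exact: semialg_ring_eq. Qed.

End Rings.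

Section Backward.
Variables (R : realType) (m n : nat) (M : set 'rV[R]_m) (N : set 'rV[R]_n).
Hypotheses (hM : semialgebraic M) (hN : semialgebraic N).
Notation V n := 'rV[R]_n.

Let M0 := M `\` sphere_end M.
Let N0 := N `\` sphere_end N.

(** Two functions correspond when they agree on the complements of the ends,
    identified by the homeomorphism. Bounded functions extend from there, and
    uniquely by density. *)
Lemma iso_of_homeo f g : compact N -> sa_homeo N0 M0 f g ->
  exists phi : {rmorphism semialg_ring hN -> bounded_semialg_ring hM}, bijective phi.
Proof.
move=> cN H; pose T (a : semialg_ring hN) (b : bounded_semialg_ring hM) :=
  forall (x : N) (y : M), N0 (set_val x) -> f (set_val x) = set_val y -> a x = b y.
have sf := homeo_sa H; have sg := homeo_saV H.
apply: (@rmorphism_of_relation _ _ T).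
- move=> a; have [F [sF cF aF]] := semialg_ring_represented a.
  have [k Fk] := compact_bounded_fun cN cF.
  have [||x /(homeo_inV H)[Nx _]|G [sG cG Gk GF]] :=
      bounded_extension hM (f := fun x => F (g x)) (k := k).
  + by sa.
  + by apply: (cont_on_comp (B := N)) (homeo_contV H) cF => x /(homeo_inV H)[].
  + exact: Fk.
  have [b [_ _ bG]] := bounded_ring_ex hM sG cG Gk.
  exists b => x y N0x xy; rewrite aF bG -xy GF; last exact: homeo_in H _ N0x.
  by rewrite (homeoK H).
- move=> b; have [G [k [[sG cG bG] Gk]]] := bounded_ring_represented b.
  have [||x /(homeo_in H)[Mx _]|F [sF cF Fk FG]] :=
      bounded_extension hN (f := fun x => G (f x)) (k := k).
  + by sa.
  + by apply: (cont_on_comp (B := M)) (homeo_cont H) cG => x /(homeo_in H)[].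
  + exact: Gk.
  have [a [_ _ aF]] := semialg_ring_ex hN sF cF.
  by exists a => x y N0x xy; rewrite aF bG -xy FG.
- move=> a b b' Tb Tb'; apply: bounded_ring_eq => y.
  have [F [k [[_ cF bF] _]]] := bounded_ring_represented b.
  have [F' [k' [[_ cF' bF'] _]]] := bounded_ring_represented b'.
  rewrite bF bF'; apply: (cont_on_dense_eq (A := M) (B := M0)) => //.
  + by move=> x [].
  + exact: end_compl_dense.
  + move=> x /[dup] M0x [Mx _]; have [Nx nx] := homeo_inV H M0x.
    rewrite -(set_val_in Mx) -bF -bF'.
    rewrite -(Tb (subtype_elt Nx)) ?set_val_in ?(homeoKV H)//.
    by apply: Tb'; rewrite ?set_val_in ?(homeoKV H).
  + exact: set_val_prop.
- move=> a a' b Ta Ta'; apply: semialg_ring_eq => y.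
  have [F [_ cF aF]] := semialg_ring_represented a.
  have [F' [_ cF' aF']] := semialg_ring_represented a'.
  rewrite aF aF'; apply: (cont_on_dense_eq (A := N) (B := N0)) => //.
  + by move=> x [].
  + exact: end_compl_dense.
  + move=> x /[dup] N0x [Nx _]; have [My ny] := homeo_in H N0x.
    rewrite -(set_val_in Nx) -aF -aF'.
    rewrite (Ta _ (subtype_elt My)) ?set_val_in//.
    by apply/esym; apply: Ta'; rewrite ?set_val_in.
  + exact: set_val_prop.
- by [].
- move=> a a' b b' Ta Ta' x y N0x xy.
  rewrite [LHS](_ : _ = a x - a' x)// [RHS](_ : _ = b y - b' y)//.
  by rewrite (Ta x y) ?(Ta' x y).
- move=> a a' b b' Ta Ta' x y N0x xy.
  rewrite [LHS](_ : _ = a x * a' x)// [RHS](_ : _ = b y * b' y)//.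
  by rewrite (Ta x y) ?(Ta' x y).
Qed.

End Backward.

(** * From isomorphisms to homeomorphisms *)

Section Evaluation.
Variables (R : realType) (m : nat) (M : set 'rV[R]_m) (hM : semialgebraic M).

Definition eval (x : M) (a : semialg_ring hM) : R := a x.

Fact eval_zmod x : GRing.zmod_morphism (eval x). Proof. by []. Qed.
Fact eval_monoid x : GRing.monoid_morphism (eval x). Proof. by []. Qed.
HB.instance Definition _ x :=
  GRing.isZmodMorphism.Build (semialg_ring hM) R (eval x) (eval_zmod x).
HB.instance Definition _ x :=
  GRing.isMonoidMorphism.Build (semialg_ring hM) R (eval x) (eval_monoid x).

Definition eval_bounded (x : M) (a : bounded_semialg_ring hM) : R := a x.

Fact eval_bounded_zmod x : GRing.zmod_morphism (eval_bounded x). Proof. by []. Qed.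
Fact eval_bounded_monoid x : GRing.monoid_morphism (eval_bounded x). Proof. by []. Qed.
HB.instance Definition _ x := GRing.isZmodMorphism.Build (bounded_semialg_ring hM) R
  (eval_bounded x) (eval_bounded_zmod x).
HB.instance Definition _ x := GRing.isMonoidMorphism.Build (bounded_semialg_ring hM) R
  (eval_bounded x) (eval_bounded_monoid x).

End Evaluation.

(** A ring endomorphism preserves squares, hence the order, and it fixes the
    rational numbers. *)
Lemma real_endomorphism_id (R : realType) (psi : {rmorphism R -> R}) c : psi c = c.
Proof.
have pos x : 0 <= x -> 0 <= psi x.
  by move=> x0; rewrite -(sqr_sqrtr x0) rmorphXn sqr_ge0.
have mono x y : x <= y -> psi x <= psi y.
  by rewrite -subr_ge0 => /pos; rewrite rmorphB subr_ge0.
have [lt|lt|//] := ltgtP (psi c) c.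
  have [q] := rat_in_itvoo lt; rewrite in_itv/= => /andP[q1 /ltW/mono].
  by rewrite fmorph_rat leNgt q1.
have [q] := rat_in_itvoo lt; rewrite in_itv/= => /andP[/ltW/mono + q2].
by rewrite fmorph_rat leNgt q2.
Qed.

Section SquareRoots.
Variable R : realType.
Notation V n := 'rV[R]_n.

Lemma sa_fun_sqrt k (F : V k -> R) : sa_fun F -> sa_fun (fun x => Num.sqrt (F x)).
Proof.
move=> sF; apply: (@sa_fun_def _ _ _ (fun x t =>
  (0 <= F x /\ 0 <= t /\ t * t = F x) \/ (F x < 0 /\ 0 = t))); last by sa.
move=> x t; split.
  case=> [[F0 [t0 <-]]|[F0 <-]]; first by rewrite -expr2 sqrtr_sqr ger0_norm.
  by rewrite ltr0_sqrtr.
move=> <-; have [F0|F0] := leP 0 (F x); [left|right].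
  by split=> //; split; [exact: sqrtr_ge0|rewrite -expr2 sqr_sqrtr].
by rewrite ltr0_sqrtr.
Qed.

Lemma cont_on_sqrt (U : pseudoMetricNormedZmodType R) (A : set U) (F : U -> R) :
  cont_on A F -> cont_on A (fun x => Num.sqrt (F x)).
Proof.
move=> cF x Ax; apply: continuous_cvg; last exact: cF.
exact: sqrt_continuous.
Qed.

End SquareRoots.

Section Forward.
Variables (R : realType) (m n : nat) (M : set 'rV[R]_m) (N : set 'rV[R]_n).
Hypotheses (hM : semialgebraic M) (hN : semialgebraic N).
Notation V n := 'rV[R]_n.
Notation sa A := (semialgebraic A).

Variable phi : {rmorphism semialg_ring hN -> bounded_semialg_ring hM}.
Hypothesis bij : bijective phi.

Let phi_inj : injective phi. Proof. exact: bij_inj. Qed.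

Let phi_surj b : exists a, phi a = b.
Proof. by case: bij => psi _ psiK; exists (psi b). Qed.

(** A nonnegative bounded function is the square of a bounded function. *)
Lemma phi_ge0_inv (a : semialg_ring hN) : (forall y, 0 <= phi a y) -> forall x, 0 <= a x.
Proof.
move=> a0 x; have [F [k [[sF cF aF] Fk]]] := bounded_ring_represented (phi a).
have F0 y : M y -> 0 <= F y.
  by move=> My; rewrite -(set_val_in My) -aF.
have [||y My|s [_ _ sE]] := bounded_ring_ex hM (F := fun y => Num.sqrt (F y)) (k := k + 1).
- exact: sa_fun_sqrt.
- exact: cont_on_sqrt.
- rewrite ger0_norm ?sqrtr_ge0// -(@ler_pXn2r _ 2)// ?nnegrE ?sqrtr_ge0//; last first.
    by rewrite addr_ge0// (le_trans _ (Fk y My)).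
  rewrite sqr_sqrtr ?F0//; have := Fk y My; have := F0 y My.
  move=> h; rewrite ger0_norm// => h'; nra.
have [t ts] := phi_surj s.
have -> : a = t * t.
  apply: phi_inj; rewrite rmorphM ts; apply: bounded_ring_eq => y.
  rewrite [RHS](_ : _ = s y * s y)// sE -expr2 sqr_sqrtr -?aF//.
by rewrite [leRHS](_ : _ = t x * t x)// -expr2 sqr_ge0.
Qed.

Lemma constants : exists C : R -> semialg_ring hN, forall c x, C c x = c.
Proof.
have /choice[C CE] : forall c, exists a : semialg_ring hN, forall x, a x = c.
  move=> c; have [a [_ _ aE]] := semialg_ring_ex hN (sa_fun_cst n c) (@cont_on_cst R _ _ N c).
  by exists a.
by exists C.
Qed.

Lemma phi_constant (a : semialg_ring hN) c : (forall x, a x = c) ->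
  forall y, phi a y = c.
Proof.
move=> ac y; have [C CE] := constants.
pose psi c := eval_bounded y (phi (C c)).
have psiB : GRing.zmod_morphism psi.
  move=> u v; rewrite /psi -rmorphB -rmorphB; congr (eval_bounded _ (phi _)).
  by apply: semialg_ring_eq => x; rewrite CE [RHS](_ : _ = C u x - C v x)// !CE.
have psiM : GRing.monoid_morphism psi.
  split.
    rewrite /psi (_ : C 1 = 1) ?rmorph1//.
    by apply: semialg_ring_eq => x; rewrite CE.
  move=> u v; rewrite /psi -rmorphM -rmorphM; congr (eval_bounded _ (phi _)).
  by apply: semialg_ring_eq => x; rewrite CE [RHS](_ : _ = C u x * C v x)// !CE.
pose Psi : {rmorphism R -> R} := HB.pack psi
  (GRing.isZmodMorphism.Build R R psi psiB) (GRing.isMonoidMorphism.Build R R psi psiM).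
have -> : a = C c by apply: semialg_ring_eq => x; rewrite CE.
exact: (real_endomorphism_id Psi c).
Qed.

(** The image of a function is bounded by a constant k; as [phi] fixes k and
    reflects positivity, k also bounds the function. *)
Lemma source_bounded (F : V n -> R) : sa_fun F -> cont_on N F ->
  exists k : R, forall x, N x -> `|F x| <= k.
Proof.
move=> sF cF; have [a [_ _ aF]] := semialg_ring_ex hN sF cF.
have [G [k [[_ _ bG] Gk]]] := bounded_ring_represented (phi a).
have bk y : `|phi a y| <= k by rewrite bG; apply: Gk; exact: set_val_prop.
have [C CE] := constants; have Ck := phi_constant (CE k).
exists k => x Nx; rewrite -(set_val_in Nx) -aF ler_norml; set z := subtype_elt Nx.
have h1 : 0 <= (C k - a) z.
  apply: phi_ge0_inv => y; rewrite rmorphB [leRHS](_ : _ = phi (C k) y - phi a y)//.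
  by rewrite Ck subr_ge0 (le_trans (ler_norm _)).
have h2 : 0 <= (C k + a) z.
  apply: phi_ge0_inv => y; rewrite rmorphD [leRHS](_ : _ = phi (C k) y + phi a y)//.
  by rewrite Ck addrC -lerBlDr sub0r; have := bk y; rewrite ler_norml => /andP[].
move: h1; rewrite [leRHS](_ : _ = C k z - a z)// CE.
move: h2; rewrite [leRHS](_ : _ = C k z + a z)// CE => h2 h1.
by apply/andP; split; lra.
Qed.

(** The norm is bounded on N, and so is the inverse of the distance to a limit
    point outside N. *)
Lemma source_compact : compact N.
Proof.
apply: bounded_closed_compact.
  have [|k Nk] := source_bounded (sa_fun_norm (@sa_map_id R n)).
    by apply: cont_on_norm; exact: cont_on_id.
  exists k; split; first exact: num_real.
  move=> x kx y Ny /=; apply: ltW; apply: le_lt_trans kx.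
  by rewrite -[leLHS]normr_id; exact: Nk.
move=> p Np; apply: contrapT => nNp.
have px x : N x -> `|p - x| != 0.
  by move=> Nx; rewrite normr_eq0 subr_eq0; apply/eqP => px; apply: nNp; rewrite px.
have [||k Nk] := source_bounded (F := fun x => `|p - x|^-1).
- by sa.
- apply: cont_on_inv => //; apply: cont_on_norm; apply: cont_onB; last exact: cont_on_id.
  exact: cont_on_cst.
have [|x /= [Nx xp]] := Np (ball p (`|k| + 1)^-1).
  by apply: nbhsx_ballx; rewrite invr_gt0 ltr_wpDl.
move: xp; rewrite -ball_normE/= => xp; have := Nk x Nx.
have px0 : 0 < `|p - x| by rewrite lt_neqAle eq_sym px// normr_ge0.
rewrite ger0_norm ?invr_ge0// leNgt => /negP; apply.
rewrite -ltf_pV2 ?posrE ?invr_gt0// ?invrK in xp; last by rewrite ltr_wpDl.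
by apply: lt_trans xp; rewrite ltr_pwDr// ler_norm.
Qed.

(** The evaluation of [phi] at a point is an evaluation: a sum of squares that
    vanishes under it is not a unit, so it has a zero. *)
Lemma point_evaluation : exists G : M -> N, forall a y, phi a y = a (G y).
Proof.
have [C CE] := constants.
have phiC c y : phi (C c) y = c by apply: phi_constant (CE c) y.
have /choice[X XE] : forall i : 'I_n, exists a : semialg_ring hN,
    forall x, a x = (set_val x : V n) 0 i.
  move=> i; have [|a [_ _ aE]] := semialg_ring_ex hN (@sa_fun_coord R n i).
    by apply: cont_on_coord; exact: cont_on_id.
  by exists a.
have zero y (a : semialg_ring hN) : exists x, (forall i, X i x = phi (X i) y) /\ a x = phi a y.
  apply: contrapT => nx.
  pose u := \sum_i (X i - C (phi (X i) y)) ^+ 2 + (a - C (phi a y)) ^+ 2.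
  have ux x : u x = \sum_i (X i x - phi (X i) y) ^+ 2 + (a x - phi a y) ^+ 2.
    rewrite -[LHS]/(eval x u) rmorphD rmorph_sum; congr (_ + _).
      by apply: eq_bigr => i _; rewrite rmorphXn rmorphB /= /eval CE.
    by rewrite rmorphXn rmorphB /= /eval CE.
  have pu : phi u y = 0.
    rewrite -[LHS]/(eval_bounded y (phi u)) rmorphD rmorph_sum !rmorphD !rmorph_sum.
    rewrite big1 => [|i _]; last first.
      by rewrite !rmorphXn !rmorphB /= /eval_bounded phiC subrr expr0n.
    by rewrite !rmorphXn !rmorphB /= /eval_bounded phiC subrr expr0n addr0.
  have u0 x : u x != 0.
    rewrite ux; apply/eqP => /eqP; rewrite paddr_eq0 ?sqr_ge0//; last first.
      by apply: sumr_ge0 => i _; rewrite sqr_ge0.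
    rewrite psumr_eq0 => [|i _]; last by rewrite sqr_ge0.
    case/andP => /allP h; rewrite sqrf_eq0 subr_eq0 => /eqP ha; apply: nx.
    exists x; split=> // i; have := h i (mem_index_enum _).
    by rewrite /= sqrf_eq0 subr_eq0 => /eqP.
  have [U [sU cU uU]] := semialg_ring_represented u.
  have [|v [_ _ vE]] := semialg_ring_ex hN (sa_fun_inv sU).
    by apply: cont_on_inv cU => x Nx; rewrite -(set_val_in Nx) -uU.
  have uv : u * v = 1.
    apply: semialg_ring_eq => x; rewrite [LHS](_ : _ = u x * v x)// vE -uU.
    by rewrite mulfV.
  have : eval_bounded y (phi (u * v)) = 1 by rewrite uv !rmorph1.
  rewrite !rmorphM [X in X * _]pu mul0r => /eqP.
  by rewrite eq_sym oner_eq0.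
have /choice[G GE] : forall y, exists x, forall a, phi a y = a x.
  move=> y; have [x [xX _]] := zero y 0.
  exists x => a; have [x' [xX' <-]] := zero y a; congr (a _).
  by apply: set_val_inj; apply/rowP => i; rewrite -!XE xX xX'.
by exists G.
Qed.

(** The coordinates of [g] are the images of the coordinate functions of N. The
    fourth clause is injectivity of [phi], the fifth its surjectivity. *)
Lemma embedding : exists g : V m -> V n,
  [/\ sa_map g, cont_on M g, forall y, M y -> N (g y),
    forall F, sa_fun F -> cont_on N F -> (forall y, M y -> F (g y) = 0) ->
      forall x, N x -> F x = 0 &
    forall B k, sa_fun B -> cont_on M B -> (forall y, M y -> `|B y| <= k) ->
      exists F, [/\ sa_fun F, cont_on N F & forall y, M y -> F (g y) = B y]].
Proof.
have [G GE] := point_evaluation.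
have /choice[g gE] : forall i : 'I_n, exists F : V m -> R, [/\ sa_fun F, cont_on M F &
    forall y : M, (set_val (G y) : V n) 0 i = F (set_val y)].
  move=> i; have [|a [_ _ aE]] := semialg_ring_ex hN (@sa_fun_coord R n i).
    by apply: cont_on_coord; exact: cont_on_id.
  have [F [k [[sF cF pF] _]]] := bounded_ring_represented (phi a).
  by exists F; split=> // y; rewrite -pF GE aE.
pose g' x : V n := \row_i g i x.
have gG y : g' (set_val y) = set_val (G y).
  by apply/rowP => i; have [_ _ ->] := gE i; rewrite mxE.
exists g'; split.
- move=> i; have [sg _ _] := gE i; rewrite /g'.
  by under eq_fun do rewrite mxE.
- apply: cont_on_rV => i; have [_ cg _] := gE i.
  by apply: cont_on_eq cg => x _; rewrite mxE.
- by move=> y My; rewrite -(set_val_in My) gG; exact: set_val_prop.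
- move=> F sF cF F0 x Nx; have [a [_ _ aF]] := semialg_ring_ex hN sF cF.
  rewrite -(set_val_in Nx) -aF (_ : a = 0)//; apply: phi_inj; rewrite rmorph0.
  apply: bounded_ring_eq => y; rewrite GE aF -gG F0//; exact: set_val_prop.
- move=> B k sB cB Bk; have [b [_ _ bE]] := bounded_ring_ex hM sB cB Bk.
  have [a ab] := phi_surj b; have [F [sF cF aF]] := semialg_ring_represented a.
  exists F; split=> // y My.
  by rewrite -(set_val_in My) gG -aF -GE ab bE.
Qed.

Lemma homeo_of_iso : compact N /\
  exists f g, sa_homeo (N `\` sphere_end N) (M `\` sphere_end M) f g.
Proof.
have cN := source_compact; split=> //.
have [g [sg cg gN gdense gsurj]] := embedding.
have ginv p (e : R) : M p -> 0 < e -> exists2 d : R, 0 < d &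
    forall y, M y -> `|g p - g y| < d -> `|p - y| < e.
  move=> Mp e0.
  (* The function min(1, |p - y|) on M is F o g with F continuous on N and zero
     at g p, so |p - y| is small when g y is close to g p. *)
  have [|||F [sF cF FE]] := gsurj (fun y => - Num.max (-1) (- `|p - y|)) 1.
  - by sa.
  - apply: (cont_on_eq (f := fun y => 0 - Num.max (-1) (0 - `|p - y|))).
      by move=> y _; rewrite !sub0r.
    apply: cont_onB; first exact: cont_on_cst.
    apply: cont_on_max; first exact: cont_on_cst.
    apply: cont_onB; first exact: cont_on_cst.
    apply: cont_on_norm; apply: cont_onB; [exact: cont_on_cst|exact: cont_on_id].
  - move=> y My; rewrite normrN ler_norml ge_max le_max lexx/=.
    by apply/andP; split; [|have := normr_ge0 (p - y)]; lra.
  have m0 : 0 < Num.min e 1 by rewrite lt_min e0 ltr01.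
  have [d d0 dF] := (cont_onP _ _).1 cF _ (gN p Mp) _ m0.
  exists d => // y My /(dF _ (gN y My)).
  rewrite !FE// subrr normr0 oppr0 (_ : Num.max (-1) 0 = 0); last first.
    by apply/max_idPr; lra.
  rewrite oppr0 sub0r opprK lt_min ltr_norml => /andP[/andP[h1 _]].
  rewrite ltr_norml => /andP[h2 _]; move: h1 h2.
  rewrite !lt_max => /orP[h1|h1] /orP[h2|h2]; lra.
have ginj x y : M x -> M y -> g x = g y -> x = y.
  move=> Mx My gxy; apply/eqP; rewrite -subr_eq0 -normr_eq0; apply/negPn/negP => n0.
  have {}n0 : 0 < `|x - y| by rewrite lt_neqAle eq_sym n0 normr_ge0.
  have [d d0 dg] := ginv x _ Mx n0.
  by have := dg y My; rewrite gxy subrr normr0 ltxx => /(_ d0).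
pose M' z := exists y, M y /\ g y = z.
have sM' : sa M' by rewrite /M'; sa.
have /choice[h hE] : forall z, exists y, if `[< M' z >] then M y /\ g y = z else y = 0.
  by move=> z; case: asboolP => [//|_]; exists 0.
have hin z : M' z -> M (h z) /\ g (h z) = z.
  by move=> Mz; have := hE z; rewrite asboolT.
have hg y : M y -> h (g y) = y.
  move=> My; have [Mh gh] : M (h (g y)) /\ g (h (g y)) = g y by apply: hin; exists y.
  exact: ginj.
have H : sa_homeo M M' g h.
  split=> //.
  - move=> i; apply: (@sa_fun_def _ _ _ (fun z t =>
      (exists y, M y /\ g y = z /\ y 0 i = t) \/ (~ M' z /\ 0 = t))); last by sa.
    move=> z t; split.
      case=> [[y [My [<- <-]]]|[nz <-]]; first by rewrite hg.
      by have := hE z; rewrite asboolF// => ->; rewrite mxE.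
    move=> <-; have [Mz|nz] := pselect (M' z); [left|right].
      by exists (h z); have [] := hin z Mz.
    by split=> //; have := hE z; rewrite asboolF// => ->; rewrite mxE.
  - by move=> y My; exists y.
  - by move=> z /hin[].
  - by move=> z /hin[].
  - apply/cont_onP => z Mz e e0; have [Mh gh] := hin z Mz.
    have [d d0 dg] := ginv _ _ Mh e0; exists d => // z' Mz' zz'.
    by have [Mh' gh'] := hin z' Mz'; apply: dg => //; rewrite gh gh'.
have M'N : M' `<=` N by move=> z [y [My <-]]; exact: gN.
have M'dense x (e : R) : N x -> 0 < e -> exists2 z, M' z & `|x - z| < e.
  move=> Nx e0; apply: contrapT => nz.
  (* Otherwise this bump function around x would vanish on g(M) but not at x. *)
  have := gdense (fun z => Num.max 0 (e - `|x - z|)) _ _ _ x Nx.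
  rewrite subrr normr0 subr0 => E.
  have /eqP : Num.max 0 e = 0.
    apply: E; first by sa.
      apply: cont_on_max; first exact: cont_on_cst.
      apply: cont_onB; first exact: cont_on_cst.
      apply: cont_on_norm; apply: cont_onB; [exact: cont_on_cst|exact: cont_on_id].
    move=> y My; apply/max_idPl; rewrite subr_le0 leNgt; apply/negP => xy.
    by apply: nz; exists (g y) => //; exists y.
  by rewrite (max_idPr (ltW e0)) gt_eqF.
have [K NK] := source_bounded (sa_fun_norm (@sa_map_id R n))
  (cont_on_norm (cont_on_id (A := N))).
have NM' p : N p -> ~ M' p -> sphere_end N p.
  move=> Np nM'p; apply: (limits_sphere_end (K := K)) => //.
  - by move=> x /NK; rewrite normr_id.
  - move=> e e0; have [z M'z pz] := M'dense p e Np e0; exists z => //.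
    by split; [exact: M'N|move=> zp; apply: nM'p; rewrite -zp].
  move=> f sf cf [k fk].
  have M'A z : M' z -> N z /\ z <> p.
    by move=> M'z; split; [exact: M'N|move=> zp; apply: nM'p; rewrite -zp].
  have [|||F [sF cF FE]] := gsurj (fun y => f (g y)) k.
  - by sa.
  - by apply: cont_on_comp cg cf => y My; apply: M'A; exists y.
  - by move=> y My; apply: fk; apply: M'A; exists y.
  have Ff x : N x /\ x <> p -> F x = f x.
    apply: (cont_on_dense_eq (A := fun x => N x /\ x <> p) (B := M')) => //.
    - by apply: cont_onW cF => z [].
    - by move=> z e [Nz _]; exact: M'dense.
    - by move=> z [y [My <-]]; exact: FE.
  exists (F p) => e e0; have [d d0 dF] := (cont_onP _ _).1 cF p Np e e0.
  by exists d => // x Ax px; rewrite -Ff// distrC; apply: dF => //; case: Ax.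
have E : N `\` sphere_end N = M' `\` sphere_end M'.
  have NE := sphere_end_dense sM' M'N M'dense NM'.
  by apply/seteqP; split=> x; [move/(NE x).1|move/(NE x).2].
by exists h, g; rewrite E; apply: sa_homeo_sym; exact: sa_homeo_end_compl.
Qed.

End Forward.

Theorem theorem3 (R : realType) (m n : nat)
    (M : set 'rV[R]_m) (N : set 'rV[R]_n)
    (hM : semialgebraic M) (hN : semialgebraic N) :
  (exists phi : {rmorphism semialg_ring hN -> bounded_semialg_ring hM},
     bijective phi) <->
  compact N /\ semialg_homeomorphic (N `\` eta_set N) (M `\` eta_set M).
Proof.
rewrite !eta_setE//.
have sE (k : nat) (X : set 'rV[R]_k) : semialgebraic X -> semialgebraic (X `\` sphere_end X).
  by move=> sX; apply: sa_and => //; apply: sa_not; exact: sa_sphere_end.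
split=> [[phi bij]|[cN [h hh]]].
  have [cN [f [g H]]] := homeo_of_iso bij; split=> //.
  by have [h [hh _]] := sa_homeo_semialg (sE _ _ hN) H; exists h.
have [f [g [H _]]] := semialg_homeo_ambient (sE _ _ hM) hh.
exact: iso_of_homeo cN H.
Qed.
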